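(* Let $q\ge2$ be an integer and let $G,H$ be groups such that $\mathcal{W}(G,\gamma_{q-1}(G),\gamma_q(G))$ and $\mathcal{W}(H,\gamma_{q-1}(H),\gamma_q(H))$ are finite dimensional. Let $\varphi\colon G\to H$ be a homomorphism and $T\colon\mathcal{W}(H,\gamma_{q-1}(H),\gamma_q(H))\to\mathcal{W}(G,\gamma_{q-1}(G),\gamma_q(G))$, $[\nu]\mapsto[\nu\circ\varphi|_{\gamma_q(G)}]$, the induced linear map. Assume $T$ is not surjective and let $t=\dim_{\mathbb{R}}\operatorname{Coker}(T)\in\mathbb{N}$. Then there exists $X\subseteq\gamma_{q+1}(G)$ such that: (1) $(X,d_{\mathrm{scl}_{G,\gamma_q(G)}})$ is isomorphic to $(\mathbb{Z}^t,\|\cdot\|_1)$ as a coarse group; in particular $X$ is not $d_{\mathrm{scl}_{G,\gamma_q(G)}}$-bounded; (2) $X$ is $d_{\mathrm{scl}_{G,\gamma_{q-1}(G)}}$-bounded; (3) $\varphi(X)$ is $d_{\mathrm{scl}_{H,\gamma_q(H)}}$-bounded.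
   Context: $\gamma_1(G)=G$, $\gamma_{k+1}(G)=[G,\gamma_k(G)]$; $[G,\gamma_q(G)]=\gamma_{q+1}(G)$. For $N\trianglelefteq G$: $\mathrm{cl}_{G,N}$ is word length on $[G,N]$ w.r.t. simple commutators $[g,x]$ ($g\in G,x\in N$), $\mathrm{scl}_{G,N}(y)=\lim_n\mathrm{cl}_{G,N}(y^n)/n$, $d_{\mathrm{scl}_{G,N}}(y_1,y_2)=\mathrm{scl}_{G,N}(y_1^{-1}y_2)$; a set is $d$-bounded if its $d$-diameter is finite. For normal $L\geqslant N$: $\mathcal{W}(G,L,N)=\mathrm{Q}(N)^G/(\mathrm{H}^1(N)^G+\{\psi|_N:\psi\in\mathrm{Q}(L)^G\})$, with $\mathrm{Q}(N)^G$ the homogeneous quasimorphisms on $N$ invariant under $G$-conjugation and $\mathrm{H}^1(N)^G$ the $G$-invariant homomorphisms. A subset $X\subseteq\gamma_{q+1}(G)$ is isomorphic to $(\mathbb{Z}^t,\|\cdot\|_1)$ as a coarse group if there is a controlled pre-coarse homomorphism $\Psi\colon\mathbb{Z}^t\to\gamma_{q+1}(G)$ with image $X$ and a map $\Phi\colon X\to\mathbb{Z}^t$, the restriction of a pre-coarse homomorphism $\gamma_{q+1}(G)\to\mathbb{Z}^t$ and controlled on $(X,d_{\mathrm{scl}_{G,\gamma_q(G)}})$, such that $\Phi\circ\Psi$ and $\Psi\circ\Phi$ are at bounded distance from the identities (pre-coarse homomorphism: $\sup d(\alpha(ab),\alpha(a)\alpha(b))<\infty$). *)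

(* Defs.v *)
From Stdlib Require Import Reals ZArith List.
From Coquelicot Require Import Coquelicot.
Open Scope R_scope.

Record group := Group {
  gcar :> Type;
  gmul : gcar -> gcar -> gcar;
  ginv : gcar -> gcar;
  gone : gcar;
  gmulA : forall x y z, gmul x (gmul y z) = gmul (gmul x y) z;
  gmul1 : forall x, gmul gone x = x;
  gmulV : forall x, gmul (ginv x) x = gone }.

Arguments gmul {g}.
Arguments ginv {g}.
Arguments gone {g}.

Definition is_hom (G H : group) (f : G -> H) : Prop :=
  forall x y : G, f (gmul x y) = gmul (f x) (f y).

Definition comm {G : group} (a b : G) : G :=
  gmul a (gmul b (gmul (ginv a) (ginv b))).

Fixpoint gpow {G : group} (x : G) (n : nat) : G :=
  match n with O => gone | S k => gmul x (gpow x k) end.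

Definition zpow {G : group} (x : G) (z : Z) : G :=
  match z with
  | Z0 => gone
  | Zpos p => gpow x (Pos.to_nat p)
  | Zneg p => ginv (gpow x (Pos.to_nat p))
  end.

Inductive gen {G : group} (S : G -> Prop) : G -> Prop :=
  | gen_one : gen S gone
  | gen_in : forall x, S x -> gen S x
  | gen_mul : forall x y, gen S x -> gen S y -> gen S (gmul x y)
  | gen_inv : forall x, gen S x -> gen S (ginv x).

Definition commsub {G : group} (N : G -> Prop) : G -> Prop :=
  gen (fun z => exists g x, N x /\ z = comm g x).

(** lower central series: lcs k = gamma_k(G) for k >= 1 (lcs 0 := G too) *)
Fixpoint lcs (G : group) (k : nat) : G -> Prop :=
  match k with
  | O => fun _ => True
  | S O => fun _ => True
  | S k' => commsub (lcs G k')
  end.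

Definition simple_comm_gen {G : group} (N : G -> Prop) (z : G) : Prop :=
  exists g x, N x /\ (z = comm g x \/ z = ginv (comm g x)).

Fixpoint gprod {G : group} (l : list G) : G :=
  match l with nil => gone | cons a l' => gmul a (gprod l') end.

Definition cl_le {G : group} (N : G -> Prop) (y : G) (n : nat) : Prop :=
  exists l : list G, (length l <= n)%nat /\ List.Forall (simple_comm_gen N) l /\ gprod l = y.

(** cl_{G,N}(y) (meaningful for y in [G,N]) *)
Definition cl {G : group} (N : G -> Prop) (y : G) : R :=
  real (Glb_Rbar (fun r => exists n, r = INR n /\ cl_le N y n)).

Definition scl {G : group} (N : G -> Prop) (y : G) : R :=
  real (Lim_seq (fun n => cl N (gpow y (S n)) / INR (S n))).

Definition dscl {G : group} (N : G -> Prop) (y1 y2 : G) : R :=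
  scl N (gmul (ginv y1) y2).

Definition dbounded {G : group} (N : G -> Prop) (X : G -> Prop) : Prop :=
  exists C, forall x y, X x -> X y -> dscl N x y <= C.

Fixpoint rsum (n : nat) (F : nat -> R) : R :=
  match n with O => 0 | S k => rsum k F + F k end.

(** Q(N)^G : G-invariant homogeneous quasimorphisms on N (represented by
    functions on G; only values on N matter) *)
Definition HQinv (G : group) (N : G -> Prop) (f : G -> R) : Prop :=
  (exists D, forall x y, N x -> N y -> Rabs (f (gmul x y) - f x - f y) <= D) /\
  (forall x (n : Z), N x -> f (zpow x n) = IZR n * f x) /\
  (forall g x, N x -> f (gmul g (gmul x (ginv g))) = f x).

Definition Hom1inv (G : group) (N : G -> Prop) (f : G -> R) : Prop :=
  (forall x y, N x -> N y -> f (gmul x y) = f x + f y) /\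
  (forall g x, N x -> f (gmul g (gmul x (ginv g))) = f x).

Definition W_denom (G : group) (L N : G -> Prop) (f : G -> R) : Prop :=
  exists h psi, Hom1inv G N h /\ HQinv G L psi /\
    forall x, N x -> f x = h x + psi x.

(** W(G,L,N) = Q(N)^G / W_denom is finite dimensional *)
Definition W_findim (G : group) (L N : G -> Prop) : Prop :=
  exists (n : nat) (fs : nat -> G -> R),
    (forall i, (i < n)%nat -> HQinv G N (fs i)) /\
    forall f, HQinv G N f ->
      exists c : nat -> R,
        W_denom G L N (fun x => f x - rsum n (fun i => c i * fs i x)).

(** Preimage in Q(N)^G of Im(T) for T : W(H,gamma_{q-1}H,gamma_q H) ->
    W(G,gamma_{q-1}G,gamma_q G), [nu] |-> [nu o phi]; i.e. the subspace
    H^1(gamma_q G)^G + Q(gamma_{q-1}G)^G|_{gamma_q G} + phi^* Q(gamma_q H)^H. *)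
Definition cokerT_denom (q : nat) (G H : group) (phi : G -> H) (f : G -> R) : Prop :=
  exists h psi nu,
    Hom1inv G (lcs G q) h /\ HQinv G (lcs G (q - 1)) psi /\
    HQinv H (lcs H q) nu /\
    forall x, lcs G q x -> f x = h x + psi x + nu (phi x).

Definition cokerT_dim (q : nat) (G H : group) (phi : G -> H) (t : nat) : Prop :=
  exists fs : nat -> G -> R,
    (forall i, (i < t)%nat -> HQinv G (lcs G q) (fs i)) /\
    (forall c : nat -> R,
       cokerT_denom q G H phi (fun x => rsum t (fun i => c i * fs i x)) ->
       forall i, (i < t)%nat -> c i = 0) /\
    (forall f, HQinv G (lcs G q) f ->
       exists c : nat -> R,
         cokerT_denom q G H phi (fun x => f x - rsum t (fun i => c i * fs i x))).

(** Z^t with the l1 norm: vectors are nat -> Z, only coordinates < t count *)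
Definition zt_add (u v : nat -> Z) : nat -> Z := fun i => (u i + v i)%Z.
Definition d1 (t : nat) (u v : nat -> Z) : R :=
  rsum t (fun i => IZR (Z.abs (u i - v i))).

(** X ⊆ Y (ambient subgroup), with metric dscl N on G, is isomorphic to
    (Z^t, l1) as a coarse group *)
Definition coarse_iso_Zt (G : group) (N Y X : G -> Prop) (t : nat) : Prop :=
  exists (Psi : (nat -> Z) -> G) (Phi : G -> (nat -> Z)),
    (forall u, Y (Psi u)) /\
    (forall x, X x <-> exists u, x = Psi u) /\
    (exists C, forall u v, dscl N (Psi (zt_add u v)) (gmul (Psi u) (Psi v)) <= C) /\
    (forall r, exists s, forall u v, d1 t u v <= r -> dscl N (Psi u) (Psi v) <= s) /\
    (exists C, forall a b, Y a -> Y b ->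
        d1 t (Phi (gmul a b)) (zt_add (Phi a) (Phi b)) <= C) /\
    (forall r, exists s, forall x y, X x -> X y -> dscl N x y <= r ->
        d1 t (Phi x) (Phi y) <= s) /\
    (exists C, forall u, d1 t (Phi (Psi u)) u <= C) /\
    (exists C, forall x, X x -> dscl N (Psi (Phi x)) x <= C).

(* Main.v *)
Require Import Defs.
From Stdlib Require Import Reals ZArith List Lra Lia ClassicalEpsilon.
From Coquelicot Require Import Coquelicot.
From mathcomp Require classical_sets.
Open Scope R_scope.

(** Write [N = [G, L]] with [L] the preceding term of the lower central series.  For an invariant
    homogeneous quasimorphism [nu] on [N], the function [(g, x) |-> nu [g, x]] on [G * L] is at
    bounded distance from a unique biadditive form.  If this form vanishes on every relation
    [[g1, x1] ... [gs, xs] = 1], it descends to an invariant homomorphism [h] of [N], and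
    [nu - h], being bounded on the commutators [[g, x]], extends to [L] by a Hahn-Banach argument
    for stable commutator length.  By linear algebra, a basis of the cokernel therefore has a dual
    family of real combinations of relations on which all the forms pulled back from [H] vanish.

    Deforming a relation into [y m = [g1, x1^m] ... [gs, xs^m]] gives a coarse homomorphism from
    the integers to [[G, N]]: it is bounded for the pair [(G, L)] because the number of factors is
    fixed, and [nu (y m)] equals [m] times the value of the form, up to a bounded error.  So the
    dual family yields the coarse copy of [Z^t], and Bavard duality (the same Hahn-Banach
    argument) bounds its image in [H]. *)

(** * Groups *)

(** The delicate point is uniformity. Bavard duality tests against all quasimorphisms of defect at
    most 3, so the error in evaluating [nu] on a deformed product may depend on [nu] only through
    its defect. It does: the form differs from [nu] on commutators by at most the defect, and on a
    relation the form is itself at most [2 D] times the length. The second bound also makes it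
    harmless to round real coefficients to integer exponents.

    Relations, rather than arbitrary words, serve a second purpose: as the product at exponent 1 is
    trivial, raising the exponent by 1 moves the product by boundedly many commutators [[g, y]] with
    [y] in [N]. Hence the products lie in [[G, N]], and the map from [Z^t] is controlled.

    The Hahn-Banach argument runs over a nonabelian [N] with integer coefficients. Gathering the
    powers of one element costs a number of commutators independent of the coefficients; multiplying
    all coefficients by [M] and letting [M] grow removes this cost. *)

Lemma gmul_inv_r {G : group} (x : G) : gmul x (ginv x) = gone.
Proof.
  rewrite <- (gmul1 _ (gmul x (ginv x))), <- (gmulV _ (ginv x)) at 1.
  rewrite <- gmulA, (gmulA _ (ginv x) x), gmulV, gmul1. apply gmulV.
Qed.

Lemma gmul_1_r {G : group} (x : G) : gmul x gone = x.
Proof. rewrite <- (gmulV _ x), gmulA, gmul_inv_r. apply gmul1. Qed.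

Lemma gmul_cancel_l {G : group} (x y z : G) : gmul x y = gmul x z -> y = z.
Proof.
  intros E. rewrite <- (gmul1 _ y), <- (gmul1 _ z), <- (gmulV _ x), <- !gmulA.
  now rewrite E.
Qed.

Lemma ginv_unique {G : group} (x y : G) : gmul x y = gone -> y = ginv x.
Proof. intros E. apply (gmul_cancel_l x). now rewrite gmul_inv_r. Qed.

Lemma gassoc {G : group} (x y z : G) : gmul (gmul x y) z = gmul x (gmul y z).
Proof. symmetry. apply gmulA. Qed.

Lemma gmul_invK {G : group} (x y : G) : gmul (ginv x) (gmul x y) = y.
Proof. now rewrite gmulA, gmulV, gmul1. Qed.

Lemma gmul_Kinv {G : group} (x y : G) : gmul x (gmul (ginv x) y) = y.
Proof. now rewrite gmulA, gmul_inv_r, gmul1. Qed.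

Lemma ginv_mul {G : group} (x y : G) : ginv (gmul x y) = gmul (ginv y) (ginv x).
Proof.
  symmetry. apply ginv_unique. now rewrite gassoc, gmul_Kinv, gmul_inv_r.
Qed.

Lemma ginv_inv {G : group} (x : G) : ginv (ginv x) = x.
Proof. symmetry. apply ginv_unique, gmulV. Qed.

Lemma ginv_1 {G : group} : ginv (@gone G) = gone.
Proof. symmetry. apply ginv_unique, gmul1. Qed.

#[local] Hint Rewrite @gassoc @gmul_1_r @gmul1 @gmulV @gmul_inv_r @gmul_invK @gmul_Kinv
  @ginv_mul @ginv_inv @ginv_1 : grp.

Ltac grp := unfold comm; autorewrite with grp; try reflexivity.

Lemma gpow_comm {G : group} (x : G) n : gmul (gpow x n) x = gmul x (gpow x n).
Proof.
  induction n as [|n IH]; simpl; [now grp|]. now rewrite gassoc, IH.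
Qed.

Lemma zpow_succ {G : group} (x : G) n : zpow x (Z.succ n) = gmul x (zpow x n).
Proof.
  destruct n as [|p|p].
  - reflexivity.
  - simpl. now rewrite Pos2Nat.inj_add, Nat.add_comm.
  - destruct (Pos.eq_dec p 1) as [->|Hp]; [simpl; now grp|].
    replace (Z.succ (Z.neg p)) with (Z.neg (Pos.pred p)) by lia. simpl.
    replace (Pos.to_nat p) with (S (Pos.to_nat (Pos.pred p))) by lia. simpl.
    rewrite <- gpow_comm. now grp.
Qed.

Lemma zpow_pred {G : group} (x : G) n : zpow x (Z.pred n) = gmul (ginv x) (zpow x n).
Proof.
  rewrite <- (Z.succ_pred n) at 2. rewrite zpow_succ. now grp.
Qed.

Lemma zpow_add {G : group} (x : G) a b : zpow x (a + b) = gmul (zpow x a) (zpow x b).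
Proof.
  induction a as [|a IH|a IH] using Z.peano_ind.
  - simpl. now grp.
  - rewrite Z.add_succ_l, !zpow_succ, IH. now grp.
  - rewrite Z.add_pred_l, !zpow_pred, IH. now grp.
Qed.

Lemma zpow_opp {G : group} (x : G) a : zpow x (- a) = ginv (zpow x a).
Proof.
  apply ginv_unique. rewrite <- zpow_add, Z.add_opp_diag_r. reflexivity.
Qed.

Lemma zpow_mul {G : group} (x : G) a b : zpow x (a * b) = zpow (zpow x a) b.
Proof.
  induction b as [|b IH|b IH] using Z.peano_ind.
  - now rewrite Z.mul_0_r.
  - rewrite Z.mul_succ_r, Z.add_comm, zpow_add, zpow_succ, IH. reflexivity.
  - rewrite zpow_pred, <- IH, <- zpow_opp, <- zpow_add. f_equal. lia.
Qed.

Lemma zpow_1_r {G : group} (x : G) : zpow x 1 = x.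
Proof. simpl. now grp. Qed.

Lemma zpow_nat {G : group} (x : G) n : zpow x (Z.of_nat n) = gpow x n.
Proof.
  induction n as [|n IH]; [reflexivity|].
  rewrite Nat2Z.inj_succ, zpow_succ, IH. reflexivity.
Qed.

Lemma zpow_conj {G : group} (g x : G) n :
  zpow (gmul g (gmul x (ginv g))) n = gmul g (gmul (zpow x n) (ginv g)).
Proof.
  induction n as [|n IH|n IH] using Z.peano_ind.
  - simpl. now grp.
  - rewrite !zpow_succ, IH. now grp.
  - rewrite !zpow_pred, IH. now grp.
Qed.

Lemma zpow_1_l {G : group} n : zpow (@gone G) n = gone.
Proof.
  induction n as [|n IH|n IH] using Z.peano_ind.
  - reflexivity.
  - now rewrite zpow_succ, gmul1.
  - rewrite zpow_pred, IH. now grp.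
Qed.

Lemma gprod_app {G : group} (l1 l2 : list G) : gprod (l1 ++ l2) = gmul (gprod l1) (gprod l2).
Proof. induction l1 as [|a l IH]; simpl; [|rewrite IH]; now grp. Qed.

(** * Normal subgroups and the lower central series *)

Definition normal {G : group} (N : G -> Prop) : Prop :=
  N gone /\ (forall x y, N x -> N y -> N (gmul x y)) /\ (forall x, N x -> N (ginv x)) /\
  (forall g x, N x -> N (gmul g (gmul x (ginv g)))).

Lemma normal_one {G : group} (N : G -> Prop) : normal N -> N gone.
Proof. now intros [H _]. Qed.

Lemma normal_mul {G : group} (N : G -> Prop) x y : normal N -> N x -> N y -> N (gmul x y).
Proof. intros (_ & H & _). apply H. Qed.

Lemma normal_inv {G : group} (N : G -> Prop) x : normal N -> N x -> N (ginv x).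
Proof. intros (_ & _ & H & _). apply H. Qed.

Lemma normal_conj {G : group} (N : G -> Prop) g x :
  normal N -> N x -> N (gmul g (gmul x (ginv g))).
Proof. intros (_ & _ & _ & H). apply H. Qed.

Lemma normal_zpow {G : group} (N : G -> Prop) x n : normal N -> N x -> N (zpow x n).
Proof.
  intros HN Hx. induction n as [|n IH|n IH] using Z.peano_ind.
  - exact (normal_one N HN).
  - rewrite zpow_succ. now apply normal_mul.
  - rewrite zpow_pred. apply normal_mul; auto. now apply normal_inv.
Qed.

Lemma normal_gprod {G : group} (N : G -> Prop) l : normal N -> List.Forall N l -> N (gprod l).
Proof.
  intros HN Hl. induction Hl; simpl; [exact (normal_one N HN)|now apply normal_mul].
Qed.

Lemma normal_comm {G : group} (N : G -> Prop) g x : normal N -> N x -> N (comm g x).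
Proof.
  intros HN Hx. replace (comm g x) with (gmul (gmul g (gmul x (ginv g))) (ginv x)) by now grp.
  apply normal_mul; [exact HN|now apply normal_conj|now apply normal_inv].
Qed.

Lemma comm_conj {G : group} (k g x : G) :
  gmul k (gmul (comm g x) (ginv k)) =
  comm (gmul k (gmul g (ginv k))) (gmul k (gmul x (ginv k))).
Proof. now grp. Qed.

Lemma comm_inv {G : group} (g x : G) :
  ginv (comm g x) = comm (ginv g) (gmul g (gmul x (ginv g))).
Proof. now grp. Qed.

Lemma commsub_normal {G : group} (N : G -> Prop) : normal N -> normal (commsub N).
Proof.
  intros HN. repeat split.
  - apply gen_one.
  - intros x y. apply gen_mul.
  - intros x. apply gen_inv.
  - intros k x Hx. induction Hx as [|x (g & y & Hy & ->)|x y _ IHx _ IHy|x _ IHx].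
    + replace (gmul k (gmul gone (ginv k))) with (@gone G) by now grp. apply gen_one.
    + rewrite comm_conj. apply gen_in. do 2 eexists. split; [|reflexivity].
      now apply normal_conj.
    + replace (gmul k (gmul (gmul x y) (ginv k))) with
        (gmul (gmul k (gmul x (ginv k))) (gmul k (gmul y (ginv k)))) by now grp.
      now apply gen_mul.
    + replace (gmul k (gmul (ginv x) (ginv k))) with (ginv (gmul k (gmul x (ginv k))))
        by now grp. now apply gen_inv.
Qed.

Lemma commsub_sub {G : group} (N : G -> Prop) x : normal N -> commsub N x -> N x.
Proof.
  intros HN Hx. induction Hx as [|x (g & y & Hy & ->)|x y _ IHx _ IHy|x _ IHx].
  - exact (normal_one N HN).
  - now apply normal_comm.
  - now apply normal_mul.
  - now apply normal_inv.
Qed.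

Lemma lcs_succ (G : group) k : lcs G (S (S k)) = commsub (lcs G (S k)).
Proof. reflexivity. Qed.

Lemma lcs_normal (G : group) k : normal (lcs G k).
Proof.
  destruct k as [|k]; [now repeat split|].
  induction k as [|k IH]; [now repeat split|]. now apply commsub_normal.
Qed.

Lemma hom_one (G H : group) (f : G -> H) : is_hom G H f -> f gone = gone.
Proof.
  intros Hf. apply (gmul_cancel_l (f gone)). rewrite <- Hf. now grp.
Qed.

Lemma hom_inv (G H : group) (f : G -> H) x : is_hom G H f -> f (ginv x) = ginv (f x).
Proof.
  intros Hf. apply ginv_unique. rewrite <- Hf, gmul_inv_r. now apply hom_one.
Qed.

Lemma hom_comm (G H : group) (f : G -> H) x y :
  is_hom G H f -> f (comm x y) = comm (f x) (f y).
Proof. intros Hf. unfold comm. now rewrite !Hf, !hom_inv by exact Hf. Qed.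

Lemma hom_zpow (G H : group) (f : G -> H) x n :
  is_hom G H f -> f (zpow x n) = zpow (f x) n.
Proof.
  intros Hf. induction n as [|n IH|n IH] using Z.peano_ind.
  - now apply hom_one.
  - now rewrite !zpow_succ, Hf, IH.
  - now rewrite !zpow_pred, Hf, IH, hom_inv.
Qed.

Lemma commsub_hom {G H : group} (phi : G -> H) (L : G -> Prop) (L' : H -> Prop) x :
  is_hom G H phi -> (forall x, L x -> L' (phi x)) -> commsub L x -> commsub L' (phi x).
Proof.
  intros Hphi HL Hx. induction Hx as [|x (g & y & Hy & ->)|x y _ IHx _ IHy|x _ IHx].
  - rewrite hom_one by exact Hphi. apply gen_one.
  - rewrite hom_comm by exact Hphi. apply gen_in. exists (phi g), (phi y). auto.
  - rewrite Hphi. now apply gen_mul.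
  - rewrite hom_inv by exact Hphi. now apply gen_inv.
Qed.

Lemma hom_lcs (G H : group) (f : G -> H) k x : is_hom G H f -> lcs G k x -> lcs H k (f x).
Proof.
  intros Hf. destruct k as [|k]; [easy|]. revert x.
  induction k as [|k IH]; [easy|]. intros x. now apply commsub_hom.
Qed.

(** * Commutator length *)

Lemma simple_comm_genE {G : group} (N : G -> Prop) z :
  normal N -> simple_comm_gen N z -> exists g x, N x /\ z = comm g x.
Proof.
  intros HN (g & x & Hx & [->| ->]); [now exists g, x|].
  rewrite comm_inv. do 2 eexists. split; [|reflexivity]. now apply normal_conj.
Qed.

Lemma cl_le_0 {G : group} (N : G -> Prop) : cl_le N gone 0.
Proof. exists nil. simpl. auto. Qed.

Lemma cl_le_mono {G : group} (N : G -> Prop) x k k' :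
  (k <= k')%nat -> cl_le N x k -> cl_le N x k'.
Proof. intros Hk (l & Hl & H). exists l. split; [lia|exact H]. Qed.

Lemma cl_le_comm {G : group} (N : G -> Prop) g x : N x -> cl_le N (comm g x) 1.
Proof.
  intros Hx. exists (comm g x :: nil). repeat split; [simpl; lia| |simpl; now grp].
  repeat constructor. exists g, x. auto.
Qed.

Lemma cl_le_mul {G : group} (N : G -> Prop) x y k k' :
  cl_le N x k -> cl_le N y k' -> cl_le N (gmul x y) (k + k').
Proof.
  intros (l & Hl & Fl & <-) (l' & Hl' & Fl' & <-). exists (l ++ l').
  rewrite length_app, gprod_app. repeat split; [lia|]. now apply List.Forall_app.
Qed.

(** The inverse of a commutator is again a commutator, so inverses need no clause. The last clause
    is there because [cl_le] bounds the length of a word without fixing it. *)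
Lemma cl_le_ind {G : group} (N : G -> Prop) (P : G -> nat -> Prop) :
  normal N -> P gone O ->
  (forall g x y k, N x -> P y k -> P (gmul (comm g x) y) (S k)) ->
  (forall x k, P x k -> P x (S k)) ->
  forall x k, cl_le N x k -> P x k.
Proof.
  intros HN P0 P1 Pmono x k (l & Hl & Fl & <-).
  induction Hl as [|k _ IH]; [|auto].
  induction Fl as [|a l Ha Fl IH]; [exact P0|].
  destruct (simple_comm_genE N a HN Ha) as (g & x & Hx & ->). now apply P1.
Qed.

Lemma cl_le_conj {G : group} (N : G -> Prop) g x k :
  normal N -> cl_le N x k -> cl_le N (gmul g (gmul x (ginv g))) k.
Proof.
  intros HN. revert x k. apply cl_le_ind; [exact HN| | |].
  - replace (gmul g (gmul gone (ginv g))) with (@gone G) by now grp. apply cl_le_0.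
  - intros h x y k Hx IH.
    replace (gmul g (gmul (gmul (comm h x) y) (ginv g))) with
      (gmul (gmul g (gmul (comm h x) (ginv g))) (gmul g (gmul y (ginv g)))) by now grp.
    rewrite comm_conj. apply (cl_le_mul N _ _ 1 k); [|exact IH].
    apply cl_le_comm. now apply normal_conj.
  - intros x k. apply cl_le_mono. lia.
Qed.

Lemma cl_le_inv {G : group} (N : G -> Prop) x k :
  normal N -> cl_le N x k -> cl_le N (ginv x) k.
Proof.
  intros HN. revert x k. apply cl_le_ind; [exact HN| | |].
  - rewrite ginv_1. apply cl_le_0.
  - intros h x y k Hx IH. rewrite ginv_mul, comm_inv, <- Nat.add_1_r.
    apply cl_le_mul; [exact IH|]. apply cl_le_comm. now apply normal_conj.
  - intros x k. apply cl_le_mono. lia.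
Qed.

Lemma cl_le_gpow {G : group} (N : G -> Prop) x k n :
  cl_le N x k -> cl_le N (gpow x n) (n * k).
Proof.
  intros Hx. induction n as [|n IH]; [apply cl_le_0|]. now apply cl_le_mul.
Qed.

Lemma commsub_cl_le {G : group} (N : G -> Prop) x :
  normal N -> commsub N x -> exists k, cl_le N x k.
Proof.
  intros HN Hx. induction Hx as [|x (g & y & Hy & ->)|x y _ (k & IHx) _ (k' & IHy)|x _ (k & IHx)].
  - exists O. apply cl_le_0.
  - exists 1%nat. now apply cl_le_comm.
  - eexists. apply cl_le_mul; eassumption.
  - exists k. now apply cl_le_inv.
Qed.

Lemma cl_le_commsub {G : group} (N : G -> Prop) x k :
  normal N -> cl_le N x k -> commsub N x.
Proof.
  intros HN. revert x k. apply cl_le_ind; [exact HN| | |auto].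
  - apply gen_one.
  - intros g x y k Hx IH. apply gen_mul; [|exact IH]. apply gen_in. now exists g, x.
Qed.

(** Up to [near N k] with [k] bounded, [N] is abelian with trivial [G]-action. *)
Definition near {G : group} (N : G -> Prop) (k : nat) (x y : G) : Prop :=
  cl_le N (gmul x (ginv y)) k.

Lemma near_refl {G : group} (N : G -> Prop) x : near N 0 x x.
Proof. unfold near. rewrite gmul_inv_r. apply cl_le_0. Qed.

Lemma near_mono {G : group} (N : G -> Prop) k k' x y :
  (k <= k')%nat -> near N k x y -> near N k' x y.
Proof. apply cl_le_mono. Qed.

Lemma near_sym {G : group} (N : G -> Prop) k x y : normal N -> near N k x y -> near N k y x.
Proof.
  unfold near. intros HN H. apply cl_le_inv in H; [|exact HN].
  now rewrite ginv_mul, ginv_inv in H.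
Qed.

Lemma near_trans {G : group} (N : G -> Prop) k k' x y z :
  near N k x y -> near N k' y z -> near N (k + k') x z.
Proof.
  unfold near. intros H H'.
  replace (gmul x (ginv z)) with (gmul (gmul x (ginv y)) (gmul y (ginv z))) by now grp.
  now apply cl_le_mul.
Qed.

Lemma near_mul {G : group} (N : G -> Prop) k k' x y x' y' :
  normal N -> near N k x y -> near N k' x' y' -> near N (k + k') (gmul x x') (gmul y y').
Proof.
  unfold near. intros HN H H'. rewrite Nat.add_comm.
  replace (gmul (gmul x x') (ginv (gmul y y'))) with
    (gmul (gmul x (gmul (gmul x' (ginv y')) (ginv x))) (gmul x (ginv y))) by now grp.
  apply cl_le_mul; [|exact H]. now apply cl_le_conj.
Qed.

Lemma near_mul_l {G : group} (N : G -> Prop) k x y z :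
  normal N -> near N k x y -> near N k (gmul z x) (gmul z y).
Proof. intros HN H. apply (near_mul N 0 k); auto using near_refl. Qed.

Lemma near_mul_r {G : group} (N : G -> Prop) k x y z :
  normal N -> near N k x y -> near N k (gmul x z) (gmul y z).
Proof.
  intros HN H. rewrite <- (Nat.add_0_r k). apply near_mul; auto using near_refl.
Qed.

Lemma near_swap {G : group} (N : G -> Prop) x y : N x -> near N 1 (gmul y x) (gmul x y).
Proof.
  unfold near. intros Hx. rewrite ginv_mul. rewrite gassoc. now apply cl_le_comm.
Qed.

Lemma near_conj {G : group} (N : G -> Prop) g x :
  N x -> near N 1 (gmul g (gmul x (ginv g))) x.
Proof. unfold near. intros Hx. rewrite !gassoc. now apply cl_le_comm. Qed.

Lemma near_cl_le {G : group} (N : G -> Prop) k k' x y :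
  near N k x y -> cl_le N y k' -> cl_le N x (k + k').
Proof.
  intros H H'. replace x with (gmul (gmul x (ginv y)) y) by now grp.
  now apply cl_le_mul.
Qed.

Lemma near_diff {G : group} (N : G -> Prop) k x y :
  normal N -> near N k x y -> cl_le N (gmul (ginv x) y) k.
Proof.
  intros HN H. apply near_sym in H; [|exact HN].
  replace (gmul (ginv x) y) with (gmul (ginv x) (gmul (gmul y (ginv x)) (ginv (ginv x))))
    by now grp.
  now apply cl_le_conj.
Qed.

(** Passing [v] over the whole power [u^n] costs the single commutator [[v, u^n]], because [u^n]
    lies in [N]. The total cost is therefore linear in [n], as scaling arguments require. *)
Lemma near_pow_mul {G : group} (N : G -> Prop) u v n :
  normal N -> N u -> near N n (gpow (gmul u v) n) (gmul (gpow u n) (gpow v n)).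
Proof.
  intros HN Hu. induction n as [|n IH].
  - simpl. rewrite gmul1. apply near_refl.
  - simpl. rewrite <- Nat.add_1_r.
    apply near_trans with (gmul (gmul u v) (gmul (gpow u n) (gpow v n))).
    + now apply near_mul_l.
    + rewrite !gassoc. apply near_mul_l; [exact HN|]. rewrite !gmulA.
      apply near_mul_r; [exact HN|]. apply near_swap.
      rewrite <- zpow_nat. now apply normal_zpow.
Qed.

(** * Extension of quasimorphisms *)

Lemma Rle_of_linear_bound (a b K : R) :
  (forall n : nat, (1 <= n)%nat -> INR n * a <= INR n * b + K) -> a <= b.
Proof.
  intros H. destruct (Rle_or_lt a b) as [|Hab]; [assumption|exfalso].
  destruct (nfloor_ex (Rabs K / (a - b))) as [n [_ Hn]].
  { apply Rdiv_le_0_compat; [apply Rabs_pos|lra]. }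
  specialize (H (S n) ltac:(lia)). rewrite S_INR in H.
  apply (Rmult_lt_compat_r (a - b)) in Hn; [|lra].
  unfold Rdiv in Hn. rewrite Rmult_assoc, Rinv_l, Rmult_1_r in Hn by lra.
  pose proof (Rle_abs K). nra.
Qed.

(** The equivalence supplies both inputs of completeness. If both sets are empty, as for a new
    element whose powers are not constrained by the old ones, any value separates them. *)
Lemma Rsep_ex (A B : R -> Prop) :
  (forall a b, A a -> B b -> a <= b) -> ((exists a, A a) <-> (exists b, B b)) ->
  exists r, (forall a, A a -> a <= r) /\ (forall b, B b -> r <= b).
Proof.
  intros HAB HE. destruct (classic (exists a, A a)) as [HA|HA].
  - destruct (proj1 HE HA) as [b0 Hb0].
    destruct (completeness A) as [r [Hub Hlub]]; [|exact HA|].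
    + exists b0. intros a Ha. now apply HAB.
    + exists r. split; [exact Hub|]. intros b Hb. apply Hlub. intros a Ha. now apply HAB.
  - exists 0. split.
    + intros a Ha. destruct HA. now exists a.
    + intros b Hb. destruct HA. apply HE. now exists b.
Qed.

Fixpoint lsum {A : Type} (f : A -> R) (l : list A) : R :=
  match l with nil => 0 | a :: l' => f a + lsum f l' end.

Lemma lsum_app {A : Type} (f : A -> R) l1 l2 : lsum f (l1 ++ l2) = lsum f l1 + lsum f l2.
Proof. induction l1 as [|a l IH]; simpl; [|rewrite IH]; ring. Qed.

(** A chain is a formal integral combination of elements [x] of a group, each carrying a
    prescribed real value. *)
Definition chain (G : group) : Type := list (Z * (G * R)).

Definition cprod {G : group} (l : chain G) : G :=
  gprod (map (fun p => zpow (fst (snd p)) (fst p)) l).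

Definition csum {G : group} (l : chain G) : R :=
  lsum (fun p => IZR (fst p) * snd (snd p)) l.

Definition cscale {G : group} (M : Z) (l : chain G) : chain G :=
  map (fun p => ((M * fst p)%Z, snd p)) l.

Definition cover {G : group} (F : G * R -> Prop) (l : chain G) : Prop :=
  List.Forall (fun p => F (snd p)) l.

(** Partial functionals (given by their graph [F]) dominated by the stable commutator length
    of chains; the term [length l] absorbs the non-commutativity of [N]. *)
Definition dominated {G : group} (N : G -> Prop) (C : R) (F : G * R -> Prop) : Prop :=
  (forall p, F p -> N (fst p)) /\
  forall l k, cover F l -> cl_le N (cprod l) k -> csum l <= C * (INR k + INR (length l)).

Lemma cprod_app {G : group} (l1 l2 : chain G) :
  cprod (l1 ++ l2) = gmul (cprod l1) (cprod l2).
Proof. unfold cprod. now rewrite map_app, gprod_app. Qed.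

Lemma csum_scale {G : group} M (l : chain G) : csum (cscale M l) = IZR M * csum l.
Proof.
  unfold csum. induction l as [|p l IH]; simpl; [ring|]. rewrite IH, mult_IZR. ring.
Qed.

Lemma cscale_length {G : group} M (l : chain G) : length (cscale M l) = length l.
Proof. apply length_map. Qed.

Lemma cover_scale {G : group} (F : G * R -> Prop) M l : cover F l -> cover F (cscale M l).
Proof. unfold cover, cscale. rewrite Forall_map. exact (fun H => H). Qed.

Lemma cprod_scale_near {G : group} (N : G -> Prop) (l : chain G) M :
  normal N -> List.Forall (fun p => N (fst (snd p))) l ->
  near N (M * length l) (cprod (cscale (Z.of_nat M) l)) (gpow (cprod l) M).
Proof.
  intros HN Hl. induction Hl as [|[n [x r]] l Hx Hl IH]; simpl in *.
  - unfold cprod; simpl. rewrite <- zpow_nat, zpow_1_l, Nat.mul_0_r. apply near_refl.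
  - replace (M * S (length l))%nat with (M * length l + M)%nat by lia.
    unfold cprod in *; simpl.
    eapply near_trans; [apply near_mul_l; [exact HN|exact IH]|].
    rewrite Z.mul_comm, zpow_mul, zpow_nat. apply near_sym; [exact HN|].
    apply near_pow_mul; [exact HN|now apply normal_zpow].
Qed.

(** Dividing by [M] leaves [k + length l], which is why the bound in [dominated] has exactly this
    shape. *)
Lemma cl_le_scale {G : group} (N : G -> Prop) (l : chain G) M k :
  normal N -> List.Forall (fun p => N (fst (snd p))) l -> cl_le N (cprod l) k ->
  cl_le N (cprod (cscale (Z.of_nat M) l)) (M * (k + length l)).
Proof.
  intros HN Hl Hk. replace (M * (k + length l))%nat with (M * length l + M * k)%nat by lia.
  eapply near_cl_le; [now apply cprod_scale_near|]. now apply cl_le_gpow.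
Qed.

Lemma cprod_inv {G : group} (F : G * R -> Prop) (l : chain G) :
  cover F l -> exists l', cover F l' /\ cprod l' = ginv (cprod l).
Proof.
  intros Hl. induction Hl as [|[n p] l Hp Hl (l' & Hl' & E)].
  - exists nil. split; [constructor|]. unfold cprod; simpl. now grp.
  - exists (l' ++ (((- n)%Z, p) :: nil)). split.
    + apply List.Forall_app. split; [exact Hl'|]. repeat constructor. exact Hp.
    + rewrite cprod_app, E. unfold cprod; simpl. rewrite zpow_opp. now grp.
Qed.

Lemma dominated_cover_normal {G : group} (N : G -> Prop) C F (l : chain G) :
  dominated N C F -> cover F l -> List.Forall (fun p => N (fst (snd p))) l.
Proof. intros [HF _]. apply Forall_impl. intros p. apply HF. Qed.

(* The two sides of the interval of admissible values at [x] are compared after scaling the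
   chains by [j2 * M] and [j1 * M], which makes the powers of [x] cancel. *)
Lemma dominated_interval {G : group} (N : G -> Prop) C F x (l1 l2 : chain G) (j1 j2 a b : nat) :
  normal N -> dominated N C F -> N x -> cover F l1 -> cover F l2 ->
  cl_le N (gmul (cprod l1) (zpow x (- Z.of_nat j1))) a ->
  cl_le N (gmul (cprod l2) (zpow x (Z.of_nat j2))) b ->
  INR j2 * csum l1 + INR j1 * csum l2 <=
  C * (INR j2 * (INR a + INR (length l1) + 1) + INR j1 * (INR b + INR (length l2) + 1)).
Proof.
  intros HN HF Hx Hl1 Hl2 Ha Hb.
  apply (Rle_of_linear_bound _ _ (C * (INR (length l1) + INR (length l2)))).
  intros M _.
  (* The power of [x] is appended as one more entry, with dummy value 0, so that the scaling lemma
     applies; this entry is the [+ 1] of the statement. *)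
  assert (S1 : forall l (j : Z) (k m : nat), cover F l ->
      cl_le N (gmul (cprod l) (zpow x j)) k ->
      cl_le N (gmul (cprod (cscale (Z.of_nat m) l)) (zpow x (Z.of_nat m * j)))
        (m * (k + S (length l)))).
  { intros l j k m Hl Hk.
    pose (l' := l ++ ((j, (x, 0)) :: nil)).
    assert (E : cprod l' = gmul (cprod l) (zpow x j)).
    { unfold l'. rewrite cprod_app. unfold cprod at 2; simpl. now grp. }
    assert (E' : cprod (cscale (Z.of_nat m) l') =
                 gmul (cprod (cscale (Z.of_nat m) l)) (zpow x (Z.of_nat m * j))).
    { unfold l', cscale. rewrite map_app, cprod_app. unfold cprod at 2; simpl. now grp. }
    rewrite <- E', Nat.add_comm, Nat.add_comm.
    replace (S (length l)) with (length l')
      by (unfold l'; rewrite length_app; simpl; lia).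
    apply cl_le_scale; [exact HN| |now rewrite E].
    apply List.Forall_app. split; [now apply (dominated_cover_normal N C F)|].
    repeat constructor. exact Hx. }
  pose proof (S1 _ _ _ (M * j2)%nat Hl1 Ha) as Ha'.
  pose proof (S1 _ _ _ (M * j1)%nat Hl2 Hb) as Hb'.
  set (m1 := Z.of_nat (M * j2)) in *. set (m2 := Z.of_nat (M * j1)) in *.
  assert (Hc : cl_le N (cprod (cscale m1 l1 ++ cscale m2 l2))
    (M * j2 * (a + S (length l1)) + M * j1 * (b + S (length l2)))).
  { rewrite cprod_app.
    replace (m2 * Z.of_nat j2)%Z with (- (m1 * - Z.of_nat j1))%Z in Hb' by (unfold m1, m2; lia).
    set (e := (m1 * - Z.of_nat j1)%Z) in *. rewrite zpow_opp in Hb'.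
    replace (gmul (cprod (cscale m1 l1)) (cprod (cscale m2 l2))) with
      (gmul (gmul (cprod (cscale m1 l1)) (zpow x e))
        (gmul (ginv (zpow x e)) (gmul (gmul (cprod (cscale m2 l2)) (ginv (zpow x e)))
           (ginv (ginv (zpow x e)))))) by now grp.
    apply cl_le_mul; [exact Ha'|]. now apply cl_le_conj. }
  apply (proj2 HF) in Hc.
  2:{ apply List.Forall_app. split; now apply cover_scale. }
  rewrite length_app, !cscale_length in Hc. unfold csum in Hc at 1.
  rewrite lsum_app in Hc. fold (csum (cscale m1 l1)) (csum (cscale m2 l2)) in Hc.
  rewrite !csum_scale in Hc. unfold m1, m2 in Hc. rewrite <- !INR_IZR_INZ in Hc.
  rewrite !plus_INR, !mult_INR, !plus_INR, !S_INR in Hc. lra.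
Qed.

(** Solved for [r], the inequality is an upper bound when [j > 0] and a lower bound when [j < 0]. By
    [dominated_interval] these are compatible, and [r] is taken in between. *)
Lemma dominated_value {G : group} (N : G -> Prop) C F x :
  normal N -> dominated N C F -> N x ->
  exists r, forall l (j : Z) b, j <> 0%Z -> cover F l ->
    cl_le N (gmul (cprod l) (zpow x j)) b ->
    csum l + IZR j * r <= C * (INR b + INR (length l) + 1).
Proof.
  intros HN HF Hx.
  destruct (Rsep_ex
    (fun v => exists l j a, (1 <= j)%nat /\ cover F l /\
       cl_le N (gmul (cprod l) (zpow x (- Z.of_nat j))) a /\
       v = (csum l - C * (INR a + INR (length l) + 1)) / INR j)
    (fun v => exists l j b, (1 <= j)%nat /\ cover F l /\
       cl_le N (gmul (cprod l) (zpow x (Z.of_nat j))) b /\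
       v = (C * (INR b + INR (length l) + 1) - csum l) / INR j)) as [r [Hlow Hup]].
  - intros ? ? (l1 & j1 & a & Hj1 & Hl1 & Ha & ->) (l2 & j2 & b & Hj2 & Hl2 & Hb & ->).
    pose proof (dominated_interval N C F x l1 l2 j1 j2 a b HN HF Hx Hl1 Hl2 Ha Hb) as HI.
    assert (0 < INR j1) by (apply lt_0_INR; lia).
    assert (0 < INR j2) by (apply lt_0_INR; lia).
    apply (Rmult_le_reg_r (INR j1 * INR j2)); [nra|]. field_simplify; lra.
  (* Inverting a chain changes the sign of the exponent of [x], so lower bounds exist exactly when
     upper bounds do. *)
  - assert (Hinv : forall l (j : Z) a, cover F l ->
       cl_le N (gmul (cprod l) (zpow x j)) a ->
       exists l', cover F l' /\ cl_le N (gmul (cprod l') (zpow x (- j))) a).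
    { intros l j a Hl Ha. destruct (cprod_inv F l Hl) as (l' & Hl' & E).
      exists l'. split; [exact Hl'|]. rewrite E, zpow_opp.
      apply cl_le_inv in Ha; [|exact HN]. rewrite ginv_mul in Ha.
      apply (cl_le_conj N (zpow x j)) in Ha; [|exact HN].
      now rewrite gassoc, gmul_Kinv in Ha. }
    split; intros (v & l & j & a & Hj & Hl & Ha & _);
      destruct (Hinv _ _ _ Hl Ha) as (l' & Hl' & Ha').
    + rewrite Z.opp_involutive in Ha'. eexists. exists l', j, a. auto.
    + eexists. exists l', j, a. auto.
  - exists r. intros l j b Hj Hl Hb.
    destruct (Z_lt_le_dec 0 j) as [Hj'|Hj'].
    + assert (Ej : j = Z.of_nat (Z.to_nat j)) by lia. set (n := Z.to_nat j) in *.
      rewrite Ej in *. rewrite <- INR_IZR_INZ.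
      assert (0 < INR n) by (apply lt_0_INR; lia).
      assert (Hr : r <= (C * (INR b + INR (length l) + 1) - csum l) / INR n).
      { apply Hup. exists l, n, b. repeat split; auto. lia. }
      apply (Rmult_le_compat_r (INR n)) in Hr; [|lra].
      unfold Rdiv in Hr. rewrite Rmult_assoc, Rinv_l in Hr by lra. lra.
    + assert (Ej : j = (- Z.of_nat (Z.to_nat (- j)))%Z) by lia.
      set (n := Z.to_nat (- j)) in *.
      rewrite Ej in *. rewrite opp_IZR, <- INR_IZR_INZ.
      assert (0 < INR n) by (apply lt_0_INR; lia).
      assert (Hr : (csum l - C * (INR b + INR (length l) + 1)) / INR n <= r).
      { apply Hlow. exists l, n, b. repeat split; auto. lia. }
      apply (Rmult_le_compat_r (INR n)) in Hr; [|lra].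
      unfold Rdiv in Hr. rewrite Rmult_assoc, Rinv_l in Hr by lra. lra.
Qed.

Definition add_point {G : group} (F : G * R -> Prop) (x : G) (r : R) : G * R -> Prop :=
  fun p => F p \/ p = (x, r).

(** Each occurrence of [x] is pushed to the right as one power, at the price of one commutator. This
    price does not depend on [M], so it vanishes after scaling. *)
Lemma chain_gather {G : group} (N : G -> Prop) F x r (l : chain G) :
  normal N -> N x -> cover (add_point F x r) l ->
  exists l' j, cover F l' /\ csum l = csum l' + IZR j * r /\
    forall M, near N (length l) (cprod (cscale M l))
      (gmul (cprod (cscale M l')) (zpow x (M * j))).
Proof.
  intros HN Hx Hl. induction Hl as [|[n p] l Hp Hl (l' & j & Hl' & E & IH)].
  - exists nil, 0%Z. split; [constructor|]. split; [unfold csum; simpl; ring|].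
    intros M. rewrite Z.mul_0_r. unfold cprod; simpl. rewrite gmul1. apply near_refl.
  - simpl in Hp. destruct Hp as [Hp|Hp].
    + exists ((n, p) :: l'), j. split; [now constructor|]. split.
      * unfold csum in *; simpl. rewrite E. ring.
      * intros M. unfold cprod in *; simpl. rewrite gassoc.
        apply (near_mono N (length l)); [lia|]. apply near_mul_l; [exact HN|]. apply IH.
    + subst p. exists l', (n + j)%Z. split; [exact Hl'|]. split.
      * unfold csum in *; simpl. rewrite E, plus_IZR. ring.
      * intros M. unfold cprod in *; simpl. rewrite <- Nat.add_1_r.
        eapply near_trans; [apply near_mul_l; [exact HN|apply IH]|].
        rewrite Z.mul_add_distr_l, zpow_add, !gmulA.
        apply near_mul_r; [exact HN|]. apply near_sym; [exact HN|].
        apply near_swap. now apply normal_zpow.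
Qed.

(** The value from [dominated_value] satisfies the required inequality up to an additive constant.
    For the chain scaled by [M] that constant stays fixed while both sides grow with [M]. *)
Lemma dominated_extend {G : group} (N : G -> Prop) C F x :
  normal N -> dominated N C F -> N x -> exists r, dominated N C (add_point F x r).
Proof.
  intros HN HF Hx. destruct (dominated_value N C F x HN HF Hx) as [r Hr]. exists r.
  assert (HFx : forall p, add_point F x r p -> N (fst p)).
  { intros p [Hp| ->]; [now apply (proj1 HF)|exact Hx]. }
  split; [exact HFx|].
  intros l k Hl Hk.
  destruct (chain_gather N F x r l HN Hx Hl) as (l' & j & Hl' & E & Hnear).
  (* In the case [j = 0] no [+ 1] arises, and [Rabs C] compensates for it, the sign of [C] being
     unknown. *)
  apply (Rle_of_linear_bound _ _ (C * (INR (length l) + INR (length l') + 1) + Rabs C)).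
  intros M HM.
  assert (Hk' : cl_le N (gmul (cprod (cscale (Z.of_nat M) l')) (zpow x (Z.of_nat M * j)))
                  (length l + M * (k + length l))).
  { eapply near_cl_le; [apply near_sym; [exact HN|apply Hnear]|].
    apply cl_le_scale; [exact HN| |exact Hk].
    revert Hl. apply Forall_impl. intros p. apply HFx. }
  pose proof (Rle_abs C). pose proof (Rle_abs (- C)). rewrite Rabs_Ropp in *.
  rewrite E. destruct (Z.eq_dec j 0) as [->|Hj].
  - rewrite Z.mul_0_r in Hk'. simpl in Hk'. rewrite gmul_1_r in Hk'.
    apply (proj2 HF) in Hk'; [|now apply cover_scale].
    rewrite csum_scale, cscale_length, <- INR_IZR_INZ in Hk'.
    rewrite plus_INR, mult_INR, plus_INR in Hk'. lra.
  - apply Hr in Hk'; [|lia|now apply cover_scale].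
    rewrite csum_scale, cscale_length, mult_IZR, <- INR_IZR_INZ in Hk'.
    rewrite plus_INR, mult_INR, plus_INR in Hk'. lra.
Qed.

Lemma dominated_total {G : group} (N : G -> Prop) C F :
  normal N -> dominated N C F ->
  exists F', (forall p, F p -> F' p) /\ dominated N C F' /\ forall x, N x -> exists r, F' (x, r).
Proof.
  intros HN HF.
  (* Zorn's lemma is applied to the part [A] added to [F], so that the union of the empty family is
     admissible: it gives back [F]. *)
  pose (P := fun A : G * R -> Prop => dominated N C (fun p => F p \/ A p)).
  destruct (@mathcomp.classical.classical_sets.Zorn_bigcup (G * R) P) as (A & HA & Hmax).
  - intros Fam HFam Htot. split.
    + intros p [Hp|[A HA Hp]]; [now apply (proj1 HF)|].
      apply (proj1 (HFam A HA)). now right.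
    + intros l k Hl Hk.
      assert (Hfin : cover F l \/ exists A, Fam A /\ cover (fun p => F p \/ A p) l).
      { clear Hk. induction Hl as [|p l Hp Hl IH]; [left; constructor|].
        destruct Hp as [Hp|[A HA Hp]]; destruct IH as [IH|(B & HB & IH)].
        - left. now constructor.
        - right. exists B. split; [exact HB|]. constructor; [now left|exact IH].
        - right. exists A. split; [exact HA|]. constructor; [now right|].
          revert IH. apply Forall_impl. intros; now left.
        - right. destruct (Htot A B HA HB) as [HAB|HBA].
          + exists B. split; [exact HB|]. constructor; [right; now apply HAB|exact IH].
          + exists A. split; [exact HA|]. constructor; [now right|].
            revert IH. apply Forall_impl. intros z [Hz|Hz]; [now left|right; now apply HBA]. }
      destruct Hfin as [H|(A & HA & H)]; [now apply (proj2 HF)|].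
      now apply (proj2 (HFam A HA)).
  - exists (fun p => F p \/ A p). split; [tauto|]. split; [exact HA|].
    intros x Hx. destruct (dominated_extend N C _ x HN HA Hx) as [r Hr].
    exists r. apply NNPP. intros Hn.
    apply (Hmax (fun p => A p \/ p = (x, r))).
    + split; [intros p; now left|]. intros Hsub. apply Hn. right. apply Hsub. now right.
    + unfold P. split.
      * intros p Hp. apply (proj1 Hr). unfold add_point. tauto.
      * intros l k Hl. apply (proj2 Hr). revert Hl. apply Forall_impl.
        intros p. unfold add_point. tauto.
Qed.

Lemma dominated_function {G : group} (N : G -> Prop) C F :
  normal N -> dominated N C F ->
  exists nu : G -> R, (forall x r, F (x, r) -> nu x = r) /\
    forall l : list (Z * G), List.Forall (fun p => N (snd p)) l ->
    forall k, cl_le N (gprod (map (fun p => zpow (snd p) (fst p)) l)) k ->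
    lsum (fun p => IZR (fst p) * nu (snd p)) l <= C * (INR k + INR (length l)).
Proof.
  intros HN HF. destruct (dominated_total N C F HN HF) as (F' & Hsub & HF' & Htot).
  (* The chain [n (x, r) - n (x, s)] has trivial product and two entries, so [n (r - s) <= 2 C] for
     all [n]: the graph is single-valued. *)
  assert (Huniq : forall x r s, F' (x, r) -> F' (x, s) -> r <= s).
  { intros x r s Hr Hs. apply (Rle_of_linear_bound _ _ (C * 2)). intros n _.
    pose proof (proj2 HF' ((Z.of_nat n, (x, r)) :: ((- Z.of_nat n)%Z, (x, s)) :: nil) 0%nat) as H.
    unfold csum, cprod in H. simpl in H. rewrite zpow_opp, gmul_1_r, gmul_inv_r in H.
    specialize (H ltac:(repeat constructor; assumption) (cl_le_0 N)).
    rewrite opp_IZR, <- !INR_IZR_INZ in H. lra. }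
  exists (fun x => epsilon (inhabits 0) (fun r => F' (x, r))).
  assert (Hnu : forall x, N x -> F' (x, epsilon (inhabits 0) (fun r => F' (x, r)))).
  { intros x Hx. apply epsilon_spec. now apply Htot. }
  set (nu := fun x => epsilon (inhabits 0) (fun r => F' (x, r))) in *.
  split.
  - intros x r Hr. assert (Hx : N x) by apply (proj1 HF (x, r) Hr). apply Hsub in Hr.
    apply Rle_antisym; eapply Huniq; eauto.
  - intros l Hl k Hk.
    pose (l' := map (fun p : Z * G => (fst p, (snd p, nu (snd p)))) l).
    assert (Hl' : cover F' l').
    { unfold cover, l'. rewrite Forall_map. revert Hl. apply Forall_impl.
      intros p Hp. simpl. now apply Hnu. }
    pose proof (proj2 HF' l' k Hl') as H.
    replace (length l') with (length l) in H by (symmetry; apply length_map).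
    replace (csum l') with (lsum (fun p => IZR (fst p) * nu (snd p)) l) in H.
    + apply H. unfold cprod, l'. rewrite map_map. exact Hk.
    + unfold l', csum. clear. induction l as [|p l IH]; simpl; [|rewrite IH]; reflexivity.
Qed.

(** Hahn-Banach for stable commutator length. *)
Theorem dominated_quasimorphism {G : group} (N : G -> Prop) C F :
  normal N -> dominated N C F ->
  exists nu : G -> R, (forall x r, F (x, r) -> nu x = r) /\
    HQinv G N nu /\
    (forall x y, N x -> N y -> Rabs (nu (gmul x y) - nu x - nu y) <= 3 * C).
Proof.
  intros HN HF. destruct (dominated_function N C F HN HF) as (nu & Hext & Hnu).
  exists nu. split; [exact Hext|].
  (* The chains [xy - y - x] and [x + y - xy] have trivial product and three entries, whence
     [3 * C]. Below, homogeneity and invariance come from chains of two entries whose coefficients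
     grow with [M] while their commutator length stays at most 1. *)
  assert (Hqm : forall x y, N x -> N y -> Rabs (nu (gmul x y) - nu x - nu y) <= 3 * C).
  { intros x y Hx Hy. assert (Hxy : N (gmul x y)) by now apply normal_mul.
    pose proof (Hnu ((1%Z, gmul x y) :: ((-1)%Z, y) :: ((-1)%Z, x) :: nil)) as H1.
    pose proof (Hnu ((1%Z, x) :: (1%Z, y) :: ((-1)%Z, gmul x y) :: nil)) as H2.
    specialize (H1 ltac:(repeat constructor; assumption) O).
    specialize (H2 ltac:(repeat constructor; assumption) O).
    simpl in H1, H2. autorewrite with grp in H1, H2.
    specialize (H1 (cl_le_0 N)). specialize (H2 (cl_le_0 N)). apply Rabs_le. lra. }
  split; [|exact Hqm]. split; [exists (3 * C); exact Hqm|]. split.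
  - intros x n Hx. assert (Hxn : N (zpow x n)) by now apply normal_zpow.
    apply Rle_antisym; apply (Rle_of_linear_bound _ _ (C * 2)); intros M _.
    + pose proof (Hnu ((Z.of_nat M, zpow x n) :: ((- (n * Z.of_nat M))%Z, x) :: nil)
        ltac:(repeat constructor; assumption) O) as H.
      simpl in H. rewrite zpow_opp, zpow_mul, gmul_1_r, gmul_inv_r in H.
      specialize (H (cl_le_0 N)). rewrite opp_IZR, mult_IZR, <- !INR_IZR_INZ in H. lra.
    + pose proof (Hnu (((n * Z.of_nat M)%Z, x) :: ((- Z.of_nat M)%Z, zpow x n) :: nil)
        ltac:(repeat constructor; assumption) O) as H.
      simpl in H. rewrite zpow_opp, zpow_mul, gmul_1_r, gmul_inv_r in H.
      specialize (H (cl_le_0 N)). rewrite opp_IZR, mult_IZR, <- !INR_IZR_INZ in H. lra.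
  - intros g x Hx. set (y := gmul g (gmul x (ginv g))).
    assert (Hy : N y) by now apply normal_conj.
    assert (Hc : forall M, cl_le N (gmul (zpow y M) (ginv (zpow x M))) 1).
    { intros M. unfold y. rewrite zpow_conj. apply near_conj. now apply normal_zpow. }
    apply Rle_antisym; apply (Rle_of_linear_bound _ _ (C * 3)); intros M _.
    + pose proof (Hnu ((Z.of_nat M, y) :: ((- Z.of_nat M)%Z, x) :: nil)
        ltac:(repeat constructor; assumption) 1%nat) as H.
      simpl in H. rewrite zpow_opp, gmul_1_r in H.
      specialize (H (Hc _)). rewrite opp_IZR, <- !INR_IZR_INZ in H. lra.
    + pose proof (Hnu ((Z.of_nat M, x) :: ((- Z.of_nat M)%Z, y) :: nil)
        ltac:(repeat constructor; assumption) 1%nat) as H.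
      simpl in H. rewrite zpow_opp, gmul_1_r in H.
      assert (Hc' := near_sym N 1 _ _ HN (Hc (Z.of_nat M))).
      specialize (H Hc'). rewrite opp_IZR, <- !INR_IZR_INZ in H. lra.
Qed.

(** * Elementary estimates for invariant homogeneous quasimorphisms *)

Definition defect_le {G : group} (N : G -> Prop) (nu : G -> R) (D : R) : Prop :=
  forall x y, N x -> N y -> Rabs (nu (gmul x y) - nu x - nu y) <= D.

Lemma HQinv_defect {G : group} (N : G -> Prop) nu :
  HQinv G N nu -> exists D, 0 < D /\ defect_le N nu D.
Proof.
  intros [[D HD] _]. exists (Rabs D + 1). pose proof (Rabs_pos D). split; [lra|].
  intros x y Hx Hy. specialize (HD x y Hx Hy). pose proof (Rle_abs D). lra.
Qed.

Lemma HQinv_zpow {G : group} (N : G -> Prop) nu x n :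
  HQinv G N nu -> N x -> nu (zpow x n) = IZR n * nu x.
Proof. intros (_ & H & _). apply H. Qed.

Lemma HQinv_conj {G : group} (N : G -> Prop) nu g x :
  HQinv G N nu -> N x -> nu (gmul g (gmul x (ginv g))) = nu x.
Proof. intros (_ & _ & H). apply H. Qed.

Lemma HQinv_one {G : group} (N : G -> Prop) nu : normal N -> HQinv G N nu -> nu gone = 0.
Proof.
  intros HN H. pose proof (HQinv_zpow N nu gone 0 H (normal_one N HN)) as E.
  simpl in E. lra.
Qed.

Lemma HQinv_inv {G : group} (N : G -> Prop) nu x : HQinv G N nu -> N x -> nu (ginv x) = - nu x.
Proof.
  intros H Hx. rewrite <- (zpow_1_r x) at 1. rewrite <- zpow_opp.
  rewrite (HQinv_zpow N) by assumption. simpl. lra.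
Qed.

Lemma HQinv_comm {G : group} (N : G -> Prop) nu D g x :
  normal N -> HQinv G N nu -> defect_le N nu D -> N x -> Rabs (nu (comm g x)) <= D.
Proof.
  intros HN H HD Hx.
  replace (comm g x) with (gmul (gmul g (gmul x (ginv g))) (ginv x)) by now grp.
  specialize (HD (gmul g (gmul x (ginv g))) (ginv x) ltac:(now apply normal_conj)
    ltac:(now apply normal_inv)).
  rewrite (HQinv_conj N) in HD by assumption.
  rewrite (HQinv_inv N nu x) in HD by assumption.
  match goal with |- Rabs ?a <= _ => match type of HD with Rabs ?b <= _ =>
    replace a with b by ring end end. exact HD.
Qed.

Lemma Rabs_sub_add (a b c D : R) : Rabs (a - b - c) <= D -> Rabs a <= D + Rabs b + Rabs c.
Proof.
  intros H. replace a with ((a - b - c) + b + c) at 1 by ring.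
  pose proof (Rabs_triang (a - b - c + b) c). pose proof (Rabs_triang (a - b - c) b). lra.
Qed.

Lemma defect_diff {G : group} (N : G -> Prop) nu D x y :
  normal N -> HQinv G N nu -> defect_le N nu D -> N x -> N y ->
  Rabs (nu (gmul (ginv x) y) - (nu y - nu x)) <= D.
Proof.
  intros HN H HD Hx Hy. specialize (HD (ginv x) y (normal_inv N x HN Hx) Hy).
  rewrite (HQinv_inv N nu x) in HD by assumption.
  match goal with |- Rabs ?a <= _ => match type of HD with Rabs ?b <= _ =>
    replace a with b by ring end end. exact HD.
Qed.

(** Each factor contributes [C] through its value and [D] through the defect. With [L = N] and
    [C = D] this gives the constant [2 D] of Bavard duality; with [L] above [N] it serves to extend
    from [N] to [L]. *)
Lemma cl_le_quasimorphism {G : group} (L N : G -> Prop) nu C D z k :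
  normal L -> normal N -> HQinv G N nu -> defect_le N nu D -> 0 <= C + D ->
  (forall g x, L x -> N (comm g x) /\ Rabs (nu (comm g x)) <= C) ->
  cl_le L z k -> N z /\ Rabs (nu z) <= (C + D) * INR k.
Proof.
  intros HL HN H HD HCD HC. revert z k. apply cl_le_ind; [exact HL| | |].
  - split; [now apply normal_one|]. rewrite (HQinv_one N) by assumption.
    rewrite Rabs_R0. simpl. lra.
  - intros g x y k Hx [Hy IH]. destruct (HC g x Hx) as [Hc Hc'].
    split; [now apply normal_mul|]. specialize (HD _ _ Hc Hy).
    apply Rabs_sub_add in HD. rewrite S_INR. lra.
  - intros x k [Hx IH]. split; [exact Hx|]. rewrite S_INR. lra.
Qed.

(** The values of [nu] on [N] form a partial functional on [L]. It is dominated: the defect compares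
    the sum of the values with [nu] of the product, and the bound on commutators compares the latter
    with commutator length over [L]. *)
Lemma extend_quasimorphism {G : group} (L N : G -> Prop) nu C :
  normal L -> normal N -> (forall x, N x -> L x) -> HQinv G N nu ->
  (forall g x, L x -> N (comm g x) /\ Rabs (nu (comm g x)) <= C) ->
  exists psi, HQinv G L psi /\ forall x, N x -> psi x = nu x.
Proof.
  intros HL HN HNL H HC. destruct (HQinv_defect N nu H) as (D & HD0 & HD).
  assert (HC0 : 0 <= C).
  { destruct (HC gone gone (normal_one L HL)) as [_ H0].
    pose proof (Rabs_pos (nu (comm gone gone))). lra. }
  destruct (dominated_quasimorphism L (C + D)
    (fun p => N (fst p) /\ snd p = nu (fst p))) as (psi & Hext & Hpsi & _); [exact HL| |].
  - split; [intros p [Hp _]; now apply HNL|].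
    intros l k Hl Hk.
    assert (HP : N (cprod l) /\ csum l <= nu (cprod l) + D * INR (length l)).
    { clear Hk. induction Hl as [|[n [x r]] l [Hx Hr] Hl [IHN IH]].
      - split; [exact (normal_one N HN)|]. unfold csum, cprod; simpl.
        rewrite (HQinv_one N) by assumption. lra.
      - simpl in Hx, Hr. subst r.
        assert (Hxn : N (zpow x n)) by now apply normal_zpow.
        unfold cprod, csum in *. simpl gprod; simpl lsum. split; [now apply normal_mul|].
        specialize (HD _ _ Hxn IHN). rewrite (HQinv_zpow N nu x) in HD by assumption.
        change (length ((n, (x, nu x)) :: l)) with (S (length l)). rewrite S_INR.
        apply Rabs_le_between in HD. simpl. lra. }
    destruct HP as [_ HP].
    destruct (cl_le_quasimorphism L N nu C D (cprod l) k) as [_ Hb]; auto; [lra|].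
    pose proof (Rle_abs (nu (cprod l))). pose proof (pos_INR (length l)). nra.
  - exists psi. split; [exact Hpsi|]. intros x Hx. now apply Hext.
Qed.

(** * Stable commutator length and Bavard duality *)

Lemma cl_bounds {G : group} (N : G -> Prop) y k : cl_le N y k -> 0 <= cl N y <= INR k.
Proof.
  intros Hk. unfold cl.
  destruct (Glb_Rbar_correct (fun r => exists n, r = INR n /\ cl_le N y n)) as [Hlb Hglb].
  specialize (Hlb (INR k) (ex_intro _ k (conj eq_refl Hk))).
  specialize (Hglb (Finite 0)).
  assert (H0 : Rbar_le 0 (Glb_Rbar (fun r => exists n, r = INR n /\ cl_le N y n))).
  { apply Hglb. intros r (n & -> & _). simpl. apply pos_INR. }
  destruct (Glb_Rbar _); simpl in *; [now split|easy|easy].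
Qed.

Lemma cl_ge {G : group} (N : G -> Prop) y k c :
  cl_le N y k -> (forall n, cl_le N y n -> c <= INR n) -> c <= cl N y.
Proof.
  intros Hk Hc. unfold cl.
  destruct (Glb_Rbar_correct (fun r => exists n, r = INR n /\ cl_le N y n)) as [Hlb Hglb].
  specialize (Hlb (INR k) (ex_intro _ k (conj eq_refl Hk))).
  assert (H0 : Rbar_le c (Glb_Rbar (fun r => exists n, r = INR n /\ cl_le N y n))).
  { apply Hglb. intros r (n & -> & Hn). simpl. now apply Hc. }
  destruct (Glb_Rbar _); simpl in *; [assumption|easy|easy].
Qed.

Lemma scl_le_eventually {G : group} (N : G -> Prop) y c n0 :
  0 <= c ->
  (forall n, (n0 <= n)%nat -> cl N (gpow y (S n)) <= c * INR (S n)) -> scl N y <= c.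
Proof.
  intros Hc H. unfold scl.
  assert (Hl : Rbar_le (Lim_seq (fun n => cl N (gpow y (S n)) / INR (S n))) c).
  { rewrite <- (Lim_seq_const c). apply Lim_seq_le_loc. exists n0. intros n Hn.
    assert (0 < INR (S n)) by (apply lt_0_INR; lia).
    apply (Rmult_le_reg_r (INR (S n))); [assumption|]. unfold Rdiv.
    rewrite Rmult_assoc, Rinv_l, Rmult_1_r by lra. now apply H. }
  (* At a limit equal to minus infinity [real] returns 0, which is where [0 <= c] enters. *)
  destruct (Lim_seq _); simpl in *; [assumption|easy|assumption].
Qed.

Lemma scl_le_cl {G : group} (N : G -> Prop) y k : cl_le N y k -> scl N y <= INR k.
Proof.
  intros Hk. apply (scl_le_eventually N y _ 0); [apply pos_INR|]. intros n _.
  rewrite Rmult_comm, <- mult_INR. apply (cl_bounds N). now apply cl_le_gpow.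
Qed.

Lemma scl_ge {G : group} (N : G -> Prop) y k c :
  cl_le N y k ->
  (forall n m, cl_le N (gpow y n) m -> c * INR n <= INR m) -> c <= scl N y.
Proof.
  intros Hk H. unfold scl.
  set (u := fun n => cl N (gpow y (S n)) / INR (S n)).
  assert (Hu : forall n, c <= u n <= INR k).
  { intros n. assert (Hn := cl_le_gpow N y k (S n) Hk).
    assert (0 < INR (S n)) by (apply lt_0_INR; lia).
    assert (E : u n * INR (S n) = cl N (gpow y (S n))).
    { unfold u, Rdiv. rewrite Rmult_assoc, Rinv_l by lra. ring. }
    split; apply (Rmult_le_reg_r (INR (S n))); auto; rewrite E.
    - apply (cl_ge N _ _ _ Hn). intros m. apply H.
    - rewrite Rmult_comm, <- mult_INR. now apply cl_bounds. }
  assert (Hlo : Rbar_le c (Lim_seq u)).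
  { rewrite <- (Lim_seq_const c). apply Lim_seq_le_loc. exists O. intros n _. apply Hu. }
  assert (Hhi : Rbar_le (Lim_seq u) (INR k)).
  { rewrite <- (Lim_seq_const (INR k)). apply Lim_seq_le_loc. exists O. intros n _. apply Hu. }
  destruct (Lim_seq u); simpl in *; [assumption|easy|easy].
Qed.

(** The easy half of Bavard duality: if [y^n] is a product of [m] commutators, homogeneity gives
    [n |nu y| <= 2 D m]. *)
Lemma quasimorphism_le_scl {G : group} (N : G -> Prop) nu D y :
  normal N -> HQinv G N nu -> 0 < D -> defect_le N nu D -> commsub N y ->
  Rabs (nu y) <= 2 * D * scl N y.
Proof.
  intros HN H HD0 HD Hy. destruct (commsub_cl_le N y HN Hy) as [k Hk].
  assert (Hs : Rabs (nu y) / (2 * D) <= scl N y).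
  { apply (scl_ge N y k); [exact Hk|]. intros n m Hm.
    destruct (cl_le_quasimorphism N N nu D D (gpow y n) m) as [_ Hb]; auto; [lra| |].
    - intros g x Hx. split; [now apply normal_comm|now apply (HQinv_comm N)].
    - rewrite <- zpow_nat in Hb.
      rewrite (HQinv_zpow N) in Hb by (auto; now apply commsub_sub).
      rewrite <- INR_IZR_INZ, Rabs_mult, (Rabs_pos_eq (INR n)) in Hb by apply pos_INR.
      apply (Rmult_le_reg_r (2 * D)); [lra|].
      replace (Rabs (nu y) / (2 * D) * INR n * (2 * D)) with (INR n * Rabs (nu y))
        by (field; lra). lra. }
  apply (Rmult_le_compat_r (2 * D)) in Hs; [|lra].
  unfold Rdiv in Hs. rewrite Rmult_assoc, Rinv_l in Hs by lra. lra.
Qed.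

Lemma chain_singleton {G : group} (y : G) s (l : chain G) :
  cover (fun p => p = (y, s)) l -> exists j, cprod l = zpow y j /\ csum l = IZR j * s.
Proof.
  intros Hl. induction Hl as [|[n p] l Hp Hl (j & E & E')].
  - exists 0%Z. unfold csum, cprod; simpl. split; [reflexivity|ring].
  - simpl in Hp. subst p. exists (n + j)%Z. unfold csum, cprod in *; simpl.
    rewrite E, E', zpow_add, plus_IZR. split; [reflexivity|ring].
Qed.

(** Either some [y^n] is a product of [k] commutators with [k + 1 < (K + 1) n], and division with
    remainder propagates this to all large powers; or the value [K + 1] at [y] is dominated with
    constant 1, the extra 1 coming from the length of the chain, and Hahn-Banach yields a
    quasimorphism of defect at most [3 * 1] violating the bound [K]. *)
Theorem bavard_bound {G : group} (N : G -> Prop) y K :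
  normal N -> commsub N y -> 0 <= K ->
  (forall nu, HQinv G N nu -> defect_le N nu 3 -> Rabs (nu y) <= K) ->
  scl N y <= K + 1.
Proof.
  intros HN Hy HK Hnu. destruct (commsub_cl_le N y HN Hy) as [k1 Hk1].
  destruct (classic (exists n k, (1 <= n)%nat /\ cl_le N (gpow y n) k /\
      INR k + 1 < (K + 1) * INR n)) as [(n & k & Hn & Hk & Hlt)|Hno].
  (* Beyond this threshold the quotient [d] is at least [n * k1]; the one commutator saved in each
     of the [d] blocks pays for the remainder, which costs [r * k1]. *)
  - apply (scl_le_eventually N y _ (n * n * k1)); [lra|]. intros m Hm.
    assert (Em : S m = (n * (S m / n) + S m mod n)%nat) by (apply Nat.div_mod; lia).
    set (d := (S m / n)%nat) in *. set (r := (S m mod n)%nat) in *.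
    assert (Hr : (r < n)%nat) by (apply Nat.mod_upper_bound; lia).
    assert (Hcl : cl_le N (gpow y (S m)) (d * k + r * k1)).
    { rewrite Em, <- zpow_nat, Nat2Z.inj_add, zpow_add, Nat2Z.inj_mul, zpow_mul, !zpow_nat.
      apply cl_le_mul; now apply cl_le_gpow. }
    apply cl_bounds in Hcl. destruct Hcl as [_ Hcl].
    eapply Rle_trans; [exact Hcl|].
    assert (Hd : (n * k1 <= d)%nat).
    { assert (n * (n * k1) < n * S d)%nat by lia.
      assert (n * k1 < S d)%nat by (eapply Nat.mul_lt_mono_pos_l; [|eassumption]; lia). lia. }
    assert (Hrk : (r * k1 <= d)%nat) by nia.
    rewrite Em, !plus_INR, !mult_INR. apply le_INR in Hrk. rewrite mult_INR in Hrk.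
    pose proof (pos_INR d). pose proof (pos_INR r).
    assert (0 <= INR d * ((K + 1) * INR n - INR k - 1)) by (apply Rmult_le_pos; lra).
    assert (0 <= (K + 1) * INR r) by (apply Rmult_le_pos; lra). nra.
  - exfalso.
    destruct (dominated_quasimorphism N 1 (fun p => p = (y, K + 1)))
      as (nu & Hext & Hq & Hd); [exact HN| |].
    + split; [intros p ->; now apply commsub_sub|]. intros l k Hl Hk.
      destruct (chain_singleton y (K + 1) l Hl) as (j & E & E').
      rewrite E' , Rmult_1_l. rewrite E in Hk.
      pose proof (pos_INR k). pose proof (pos_INR (length l)).
      destruct (Z_lt_le_dec 0 j) as [Hj|Hj].
      * rewrite <- (Z2Nat.id j) in * by lia. rewrite zpow_nat in Hk.
        rewrite <- INR_IZR_INZ.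
        destruct l as [|p l].
        { unfold csum in E'. simpl in E'. rewrite <- INR_IZR_INZ in E'.
          simpl (length _). simpl INR at 3. lra. }
        simpl length. rewrite S_INR. pose proof (pos_INR (length l)).
        apply Rnot_lt_le. intros Hlt. apply Hno. exists (Z.to_nat j), k.
        split; [lia|]. split; [exact Hk|]. lra.
      * apply IZR_le in Hj. nra.
    + rewrite Rmult_1_r in Hd. specialize (Hnu nu Hq Hd).
      rewrite (Hext y (K + 1) eq_refl), Rabs_pos_eq in Hnu by lra. lra.
Qed.

(** * The bilinear form of an invariant quasimorphism *)

Lemma Req_of_linear_bound (a b K : R) :
  (forall n : nat, Rabs (INR n * a - INR n * b) <= K) -> a = b.
Proof.
  intros H. apply Rle_antisym; apply (Rle_of_linear_bound _ _ K); intros n _;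
    specialize (H n); apply Rabs_le_between in H; lra.
Qed.

(** Comparing [a m] and [a n] with [a (m * n)] puts every [(a n - D) / n] below every
    [(a m + D) / m]; a separating [c] then approximates with the same constant [D]. *)
Lemma homogenize (a : nat -> R) (D : R) :
  (forall m n, Rabs (a (m + n)%nat - a m - a n) <= D) ->
  exists c, forall n, Rabs (a n - INR n * c) <= D.
Proof.
  intros Ha.
  assert (Hmul : forall n m, (1 <= m)%nat ->
    Rabs (a (m * n)%nat - INR m * a n) <= (INR m - 1) * D).
  { intros n m Hm. induction Hm as [|m Hm IH].
    - simpl. rewrite Nat.add_0_r. replace (a n - 1 * a n) with 0 by ring.
      rewrite Rabs_R0. lra.
    - specialize (Ha n (m * n)%nat). simpl Nat.mul. rewrite S_INR.
      apply Rabs_le_between in Ha. apply Rabs_le_between in IH. apply Rabs_le. lra. }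
  assert (H0 : Rabs (a O) <= D).
  { specialize (Ha O O). simpl in Ha. apply Rabs_le_between in Ha. apply Rabs_le. lra. }
  assert (HD : 0 <= D) by (pose proof (Rabs_pos (a O)); lra).
  assert (Hsep : forall m n, (1 <= m)%nat -> (1 <= n)%nat ->
    (a n - D) / INR n <= (a m + D) / INR m).
  { intros m n Hm Hn.
    assert (Hm' : 0 < INR m) by (apply lt_0_INR; lia).
    assert (Hn' : 0 < INR n) by (apply lt_0_INR; lia).
    assert (H1 := Hmul n m Hm). assert (H2 := Hmul m n Hn). rewrite Nat.mul_comm in H2.
    apply Rabs_le_between in H1. apply Rabs_le_between in H2.
    apply (Rmult_le_reg_r (INR m * INR n)); [nra|]. field_simplify; [|lra|lra]. lra. }
  destruct (Rsep_ex (fun v => exists n, (1 <= n)%nat /\ v = (a n - D) / INR n)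
    (fun v => exists n, (1 <= n)%nat /\ v = (a n + D) / INR n)) as (c & Hlo & Hhi).
  - intros ? ? (n & Hn & ->) (m & Hm & ->). now apply Hsep.
  - split; intros (v & n & Hn & _); eexists; exists n; auto.
  - exists c. intros n. destruct n as [|n].
    + simpl INR. rewrite Rmult_0_l, Rminus_0_r. exact H0.
    + assert (Hn : 0 < INR (S n)) by (apply lt_0_INR; lia).
      assert (Hn1 : (1 <= S n)%nat) by lia.
      specialize (Hlo _ (ex_intro _ (S n) (conj Hn1 eq_refl))).
      specialize (Hhi _ (ex_intro _ (S n) (conj Hn1 eq_refl))).
      apply (Rmult_le_compat_r (INR (S n))) in Hlo; [|lra].
      apply (Rmult_le_compat_r (INR (S n))) in Hhi; [|lra].
      unfold Rdiv in Hlo, Hhi. rewrite Rmult_assoc, Rinv_l in Hlo, Hhi by lra.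
      apply Rabs_le. lra.
Qed.

Definition biadditive {G : group} (L : G -> Prop) (B : G -> G -> R) : Prop :=
  (forall g h x, L x -> B (gmul g h) x = B g x + B h x) /\
  (forall g x y, L x -> L y -> B g (gmul x y) = B g x + B g y).

Definition comm_form {G : group} (L : G -> Prop) (nu : G -> R) (D : R) (B : G -> G -> R) : Prop :=
  biadditive L B /\ forall g x, L x -> Rabs (nu (comm g x) - B g x) <= D.

Lemma additive_zpow {G : group} (N : G -> Prop) (f : G -> R) x n :
  normal N -> (forall x y, N x -> N y -> f (gmul x y) = f x + f y) -> N x ->
  f (zpow x n) = IZR n * f x.
Proof.
  intros HN Hf Hx.
  assert (H1 : f gone = 0).
  { pose proof (Hf gone gone (normal_one N HN) (normal_one N HN)) as E.
    rewrite gmul1 in E. lra. }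
  assert (Hp : forall n, N (zpow x n)) by (intros; now apply normal_zpow).
  induction n as [|n IH|n IH] using Z.peano_ind.
  - simpl. rewrite H1. ring.
  - rewrite zpow_succ, Hf, IH, succ_IZR by auto. ring.
  - pose proof (Hf x (zpow x (Z.pred n)) Hx (Hp _)) as E.
    rewrite <- zpow_succ, Z.succ_pred, IH in E. rewrite <- Z.sub_1_r in *.
    rewrite minus_IZR. lra.
Qed.

Lemma biadditive_zpow {G : group} (L : G -> Prop) B g x n :
  normal L -> biadditive L B -> L x -> B g (zpow x n) = IZR n * B g x.
Proof. intros HL [_ HB]. apply additive_zpow; auto. Qed.

Lemma biadditive_inv {G : group} (L : G -> Prop) B g x :
  biadditive L B -> L x -> B (ginv g) x = - B g x.
Proof.
  intros [HB _] Hx. pose proof (HB gone gone x Hx) as E1.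
  pose proof (HB g (ginv g) x Hx) as E2. rewrite gmul1 in E1. rewrite gmul_inv_r in E2. lra.
Qed.

Lemma comm_mul_l {G : group} (g h x : G) :
  comm (gmul g h) x = gmul (gmul g (gmul (comm h x) (ginv g))) (comm g x).
Proof. now grp. Qed.

Lemma comm_mul_r {G : group} (g x y : G) :
  comm g (gmul x y) = gmul (comm g x) (gmul x (gmul (comm g y) (ginv x))).
Proof. now grp. Qed.

(* Homogenising [nu [g, x^n]] in [n] makes the form exactly additive in [g]; replacing [g] by
   [g^n] then makes it exactly additive in [x]. *)
Lemma comm_form_exists {G : group} (L N : G -> Prop) nu D :
  normal L -> normal N -> (forall g x, L x -> N (comm g x)) ->
  HQinv G N nu -> defect_le N nu D ->
  exists B, comm_form L nu D B.
Proof.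
  intros HL HN HLN H HD.
  assert (Hl : forall g h x, L x ->
    Rabs (nu (comm (gmul g h) x) - nu (comm g x) - nu (comm h x)) <= D).
  { intros g h x Hx. rewrite comm_mul_l.
    specialize (HD (gmul g (gmul (comm h x) (ginv g))) (comm g x)
      ltac:(apply normal_conj; auto) ltac:(auto)).
    rewrite (HQinv_conj N) in HD by auto.
    eapply Rle_trans; [right|exact HD]. f_equal. ring. }
  assert (Hr : forall g x y, L x -> L y ->
    Rabs (nu (comm g (gmul x y)) - nu (comm g x) - nu (comm g y)) <= D).
  { intros g x y Hx Hy. rewrite comm_mul_r.
    specialize (HD (comm g x) (gmul x (gmul (comm g y) (ginv x)))
      ltac:(auto) ltac:(apply normal_conj; auto)).
    rewrite (HQinv_conj N) in HD by auto. exact HD. }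
  assert (Hex : forall g x, exists c, L x ->
    forall n, Rabs (nu (comm g (zpow x (Z.of_nat n))) - INR n * c) <= D).
  { intros g x. destruct (classic (L x)) as [Hx|Hx]; [|exists 0; tauto].
    destruct (homogenize (fun n => nu (comm g (zpow x (Z.of_nat n)))) D) as [c Hc].
    - intros m n. rewrite Nat2Z.inj_add, zpow_add. apply Hr; now apply normal_zpow.
    - now exists c. }
  pose (B := fun g x => proj1_sig (constructive_indefinite_description _ (Hex g x))).
  assert (HB : forall g x, L x ->
    forall n, Rabs (nu (comm g (zpow x (Z.of_nat n))) - INR n * B g x) <= D).
  { intros g x. exact (proj2_sig (constructive_indefinite_description _ (Hex g x))). }
  clearbody B. exists B.
  (* The case [n = 1] keeps the error at the defect itself, hence uniform over quasimorphisms of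
     bounded defect. *)
  assert (H1 : forall g x, L x -> Rabs (nu (comm g x) - B g x) <= D).
  { intros g x Hx. specialize (HB g x Hx 1%nat). simpl Z.of_nat in HB.
    rewrite zpow_1_r in HB. simpl INR in HB. now rewrite Rmult_1_l in HB. }
  assert (Hadd : forall g h x, L x -> B (gmul g h) x = B g x + B h x).
  { intros g h x Hx. apply (Req_of_linear_bound _ _ (4 * D)). intros n.
    pose proof (HB g x Hx n) as E1. pose proof (HB h x Hx n) as E2.
    pose proof (HB (gmul g h) x Hx n) as E3.
    pose proof (Hl g h (zpow x (Z.of_nat n)) ltac:(now apply normal_zpow)) as E4.
    apply Rabs_le_between in E1, E2, E3, E4. apply Rabs_le. lra. }
  assert (Hpow : forall g x n, L x -> B (gpow g n) x = INR n * B g x).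
  { intros g x n Hx. assert (E : B gone x = 0).
    { pose proof (Hadd gone gone x Hx) as E. rewrite gmul1 in E. lra. }
    induction n as [|n IH]; [simpl; lra|]. rewrite S_INR. simpl gpow.
    rewrite Hadd, IH by exact Hx. ring. }
  repeat split; [exact Hadd| |exact H1].
  intros g x y Hx Hy. apply (Req_of_linear_bound _ _ (4 * D)). intros n.
  rewrite Rmult_plus_distr_l, <- !Hpow by (try apply normal_mul; assumption).
  assert (Hxy : L (gmul x y)) by now apply normal_mul.
  pose proof (H1 (gpow g n) x Hx) as E1. pose proof (H1 (gpow g n) y Hy) as E2.
  pose proof (H1 (gpow g n) _ Hxy) as E3. pose proof (Hr (gpow g n) x y Hx Hy) as E4.
  apply Rabs_le_between in E1, E2, E3, E4. apply Rabs_le. lra.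
Qed.

(** For [x] in [N] the values [nu [g, x^n]] are bounded by the defect, while the form is linear in
    [n]. *)
Lemma comm_form_vanish {G : group} (L N : G -> Prop) nu D B g x :
  normal L -> normal N -> (forall x, N x -> L x) -> HQinv G N nu ->
  comm_form L nu D B -> N x -> B g x = 0.
Proof.
  intros HL HN HNL H [HB HBD] Hx. destruct (HQinv_defect N nu H) as (D' & _ & HD').
  apply (Req_of_linear_bound _ _ (D + D')). intros n.
  pose proof (HBD g (zpow x (Z.of_nat n)) ltac:(apply normal_zpow; auto)) as E1.
  pose proof (HQinv_comm N nu D' g (zpow x (Z.of_nat n)) HN H HD'
    ltac:(apply normal_zpow; auto)) as E2.
  rewrite (biadditive_zpow L) in E1 by auto. rewrite <- INR_IZR_INZ in E1.
  apply Rabs_le_between in E1, E2. apply Rabs_le. lra.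
Qed.

(** A word [[(g1, x1); ...]] stands for the product of the [[gi, xi]]; [wprod W m] is the
    deformed product of the [[gi, xi^m]]. *)
Definition wprod {G : group} (W : list (G * G)) (m : Z) : G :=
  gprod (map (fun p => comm (fst p) (zpow (snd p) m)) W).

Definition wform {G : group} (B : G -> G -> R) (W : list (G * G)) : R :=
  lsum (fun p => B (fst p) (snd p)) W.

Definition wover {G : group} (L : G -> Prop) (W : list (G * G)) : Prop :=
  List.Forall (fun p => L (snd p)) W.

Lemma wprod_normal {G : group} (L N : G -> Prop) W m :
  normal L -> normal N -> (forall g x, L x -> N (comm g x)) -> wover L W -> N (wprod W m).
Proof.
  intros HL HN HLN HW. apply (normal_gprod N); [exact HN|]. rewrite Forall_map.
  revert HW. apply Forall_impl. intros p Hp. apply HLN. now apply normal_zpow.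
Qed.

(** Each letter costs [D] for replacing [nu] by the form and [D] for splitting the product, whatever
    [m] is. *)
Lemma wprod_form {G : group} (L N : G -> Prop) nu D B W m :
  normal L -> normal N -> (forall g x, L x -> N (comm g x)) -> HQinv G N nu ->
  defect_le N nu D -> comm_form L nu D B -> wover L W ->
  Rabs (nu (wprod W m) - IZR m * wform B W) <= 2 * D * INR (length W).
Proof.
  intros HL HN HLN H HD [HB HBD] HW. induction HW as [|[g x] W Hx HW IH].
  - unfold wprod, wform; simpl. rewrite (HQinv_one N) by assumption.
    rewrite Rmult_0_r, Rminus_0_r, Rabs_R0. lra.
  - simpl in Hx. assert (Hxm : L (zpow x m)) by now apply normal_zpow.
    pose proof (HD _ _ (HLN g _ Hxm) (wprod_normal L N W m HL HN HLN HW)) as E1.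
    pose proof (HBD g _ Hxm) as E2. rewrite (biadditive_zpow L) in E2 by auto.
    change (wprod ((g, x) :: W) m) with (gmul (comm g (zpow x m)) (wprod W m)).
    change (wform B ((g, x) :: W)) with (B g x + wform B W).
    simpl length. rewrite S_INR.
    apply Rabs_le_between in E1, E2, IH. apply Rabs_le. lra.
Qed.

Lemma wprod_surj {G : group} (L : G -> Prop) z :
  normal L -> commsub L z -> exists W, wover L W /\ wprod W 1 = z.
Proof.
  intros HL Hz. destruct (commsub_cl_le L z HL Hz) as [k Hk]. revert z k Hk Hz.
  assert (Hind : forall z k, cl_le L z k -> exists W, wover L W /\ wprod W 1 = z).
  { apply cl_le_ind; [exact HL| | |auto].
    - exists nil. split; [constructor|reflexivity].
    - intros g x y k Hx (W & HW & <-). exists ((g, x) :: W).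
      split; [now constructor|]. unfold wprod; simpl. now rewrite gmul_1_r. }
  intros z k Hk _. now apply (Hind z k).
Qed.

Lemma Hom1inv_HQinv {G : group} (N : G -> Prop) h :
  normal N -> Hom1inv G N h -> HQinv G N h.
Proof.
  intros HN [Hm Hc]. repeat split; [| |exact Hc].
  - exists 0. intros x y Hx Hy. rewrite Hm by assumption.
    replace (h x + h y - h x - h y) with 0 by ring. rewrite Rabs_R0. lra.
  - intros x n Hx. now apply (additive_zpow N).
Qed.

Lemma HQinv_sub {G : group} (N : G -> Prop) f g :
  HQinv G N f -> HQinv G N g -> HQinv G N (fun x => f x - g x).
Proof.
  intros ([D HD] & Hz & Hc) ([D' HD'] & Hz' & Hc'). repeat split.
  - exists (D + D'). intros x y Hx Hy. specialize (HD x y Hx Hy). specialize (HD' x y Hx Hy).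
    apply Rabs_le_between in HD, HD'. apply Rabs_le. lra.
  - intros x n Hx. rewrite Hz, Hz' by exact Hx. ring.
  - intros g0 x Hx. now rewrite Hc, Hc'.
Qed.

(** Additivity with values in a commutative group makes the first conjugation invisible; for the
    second, [k x k^-1 = [k, x] x] and the form vanishes on [[k, x]]. *)
Lemma biadditive_conj {G : group} (L : G -> Prop) B k g x :
  normal L -> biadditive L B -> (forall g k x, L x -> B g (comm k x) = 0) -> L x ->
  B (gmul k (gmul g (ginv k))) (gmul k (gmul x (ginv k))) = B g x.
Proof.
  intros HL HB H0 Hx.
  assert (Hx' : L (gmul k (gmul x (ginv k)))) by now apply normal_conj.
  rewrite !(proj1 HB), (biadditive_inv L) by assumption.
  replace (gmul k (gmul x (ginv k))) with (gmul (comm k x) x) in * by now grp.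
  assert (Hc : L (comm k x)) by now apply normal_comm.
  rewrite !(proj2 HB), !H0 by assumption. ring.
Qed.

(* If the form vanishes on the relations between the generators [[g, x]] of [[G, L]], it
   descends to an invariant homomorphism [h] of [[G, L]], and [nu - h] is bounded on these
   generators, so that it extends to [L]. *)
Theorem quasimorphism_decomposition {G : group} (L : G -> Prop) nu D B :
  normal L -> HQinv G (commsub L) nu -> comm_form L nu D B ->
  (forall W, wover L W -> wprod W 1 = gone -> wform B W = 0) ->
  exists h psi, Hom1inv G (commsub L) h /\ HQinv G L psi /\
    forall x, commsub L x -> nu x = h x + psi x.
Proof.
  intros HL H HB HW.
  assert (HN : normal (commsub L)) by now apply commsub_normal.
  assert (HNL : forall x, commsub L x -> L x) by (intros; now apply commsub_sub).
  assert (HLN : forall g x, L x -> commsub L (comm g x)).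
  { intros g x Hx. apply gen_in. now exists g, x. }
  (* The graph of the future [h]: it is compatible with products, inverses and conjugation, and the
     hypothesis on relations makes it single-valued. *)
  pose (rep := fun z r => exists W, wover L W /\ wprod W 1 = z /\ wform B W = r).
  assert (rep_mul : forall z z' r r', rep z r -> rep z' r' -> rep (gmul z z') (r + r')).
  { intros z z' r r' (W & HW1 & <- & <-) (W' & HW1' & <- & <-). exists (W ++ W').
    repeat split; [now apply List.Forall_app| |apply lsum_app].
    unfold wprod. now rewrite map_app, gprod_app. }
  assert (rep_comm : forall g x, L x -> rep (comm g x) (B g x)).
  { intros g x Hx. exists ((g, x) :: nil). repeat split; [now repeat constructor| |].
    - unfold wprod; simpl. now rewrite !gmul_1_r.
    - unfold wform; simpl. ring. }
  assert (rep_one : rep gone 0).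
  { exists nil. repeat split. constructor. }
  assert (HB0 : forall g k x, L x -> B g (comm k x) = 0).
  { intros g k x Hx. apply (comm_form_vanish L (commsub L) nu D); auto. }
  assert (rep_conj : forall k z r, rep z r -> rep (gmul k (gmul z (ginv k))) r).
  { intros k z r (W & HW1 & <- & <-). induction HW1 as [|[g x] W Hx HW1 IH].
    - unfold wprod, wform; simpl. rewrite gmul1, gmul_inv_r. exact rep_one.
    - change (wform B ((g, x) :: W)) with (B g x + wform B W).
      change (wprod ((g, x) :: W) 1) with (gmul (comm g (zpow x 1)) (wprod W 1)).
      rewrite zpow_1_r.
      replace (gmul k (gmul (gmul (comm g x) (wprod W 1)) (ginv k))) with
        (gmul (gmul k (gmul (comm g x) (ginv k))) (gmul k (gmul (wprod W 1) (ginv k))))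
        by now grp.
      apply rep_mul; [|exact IH]. rewrite comm_conj.
      rewrite <- (biadditive_conj L B k g x HL (proj1 HB) HB0 Hx).
      apply rep_comm. now apply normal_conj. }
  assert (rep_inv : forall z r, rep z r -> rep (ginv z) (- r)).
  { intros z r (W & HW1 & <- & <-). induction HW1 as [|[g x] W Hx HW1 IH].
    - unfold wprod, wform; simpl. rewrite ginv_1, Ropp_0. exact rep_one.
    - change (wform B ((g, x) :: W)) with (B g x + wform B W).
      change (wprod ((g, x) :: W) 1) with (gmul (comm g (zpow x 1)) (wprod W 1)).
      simpl in Hx. rewrite zpow_1_r, ginv_mul, Ropp_plus_distr, Rplus_comm, comm_inv.
      apply rep_mul; [exact IH|].
      rewrite <- (biadditive_inv L B g x (proj1 HB) Hx).
      rewrite <- (biadditive_conj L B g (ginv g) x HL (proj1 HB) HB0 Hx).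
      replace (gmul g (gmul (ginv g) (ginv g))) with (ginv g) by now grp.
      apply rep_comm. now apply normal_conj. }
  assert (rep_uniq : forall z r r', rep z r -> rep z r' -> r = r').
  { intros z r r' Hr Hr'. pose proof (rep_mul _ _ _ _ Hr (rep_inv _ _ Hr')) as (W & HW1 & E & E').
    rewrite gmul_inv_r in E. rewrite (HW W HW1 E) in E'. lra. }
  pose (h := fun z => epsilon (inhabits 0) (rep z)).
  assert (Hh : forall z, commsub L z -> rep z (h z)).
  { intros z Hz. apply epsilon_spec. destruct (wprod_surj L z HL Hz) as (W & HW1 & E).
    exists (wform B W), W. auto. }
  assert (Hhom : Hom1inv G (commsub L) h).
  { split.
    - intros x y Hx Hy. apply (rep_uniq (gmul x y)); [|now apply rep_mul; apply Hh].
      apply Hh. now apply normal_mul.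
    - intros g x Hx. eapply rep_uniq; [|apply rep_conj, Hh, Hx].
      apply Hh. now apply normal_conj. }
  destruct (extend_quasimorphism L (commsub L) (fun x => nu x - h x) D)
    as (psi & Hpsi & Hext); auto.
  - apply HQinv_sub; [exact H|]. now apply Hom1inv_HQinv.
  - intros g x Hx. split; [now apply HLN|].
    rewrite (rep_uniq _ _ _ (Hh _ (HLN g x Hx)) (rep_comm g x Hx)). now apply HB.
  - exists h, psi. repeat split; try apply Hhom; try apply Hpsi.
    intros x Hx. rewrite Hext by exact Hx. ring.
Qed.

(** Converse of [quasimorphism_decomposition]. As [psi] is bounded on all [[g, x^n]] while [h
    [g, x^n]] is linear in [n], the form is exactly [h [g, x]], and a homomorphism vanishes on a
    relation. *)
Lemma wform_relation {G : group} (L : G -> Prop) nu h psi D B W :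
  normal L -> Hom1inv G (commsub L) h -> HQinv G L psi ->
  (forall x, commsub L x -> nu x = h x + psi x) ->
  comm_form L nu D B -> wover L W -> wprod W 1 = gone -> wform B W = 0.
Proof.
  intros HL Hh Hpsi E [HB HBD] HW HW1.
  assert (HN : normal (commsub L)) by now apply commsub_normal.
  assert (HLN : forall g x, L x -> commsub L (comm g x)).
  { intros g x Hx. apply gen_in. now exists g, x. }
  assert (Hh' := Hom1inv_HQinv _ _ HN Hh).
  destruct (HQinv_defect L psi Hpsi) as (D' & _ & HD').
  assert (Hhpow : forall g x n, L x -> h (comm g (zpow x n)) = IZR n * h (comm g x)).
  { intros g x n Hx.
    apply (additive_zpow L (fun x => h (comm g x))); [exact HL| |exact Hx].
    intros y z Hy Hz. rewrite comm_mul_r, (proj1 Hh), (proj2 Hh); auto.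
    apply normal_conj; auto. }
  assert (HBh : forall g x, L x -> B g x = h (comm g x)).
  { intros g x Hx. apply (Req_of_linear_bound _ _ (D + D')). intros n.
    assert (Hxn : L (zpow x (Z.of_nat n))) by now apply normal_zpow.
    pose proof (HBD g _ Hxn) as E1.
    pose proof (HQinv_comm L psi D' g _ HL Hpsi HD' Hxn) as E2.
    rewrite E, Hhpow, (biadditive_zpow L), <- INR_IZR_INZ in E1 by auto.
    apply Rabs_le_between in E1, E2. apply Rabs_le. lra. }
  replace (wform B W) with (h (wprod W 1)).
  - rewrite HW1. now apply (HQinv_one (commsub L)).
  - clear HW1. induction HW as [|[g x] W Hx HW IH].
    + now apply (HQinv_one (commsub L)).
    + change (wform B ((g, x) :: W)) with (B g x + wform B W).
      change (wprod ((g, x) :: W) 1) with (gmul (comm g (zpow x 1)) (wprod W 1)).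
      simpl in Hx. rewrite zpow_1_r, (proj1 Hh), IH, HBh; auto.
      now apply (wprod_normal L).
Qed.

(** * Dual families of relations *)

Lemma rsum_ext n F F' : (forall i, (i < n)%nat -> F i = F' i) -> rsum n F = rsum n F'.
Proof.
  induction n as [|n IH]; simpl; intros H; [reflexivity|]. rewrite IH, H; auto.
Qed.

Lemma rsum_plus n F F' : rsum n (fun i => F i + F' i) = rsum n F + rsum n F'.
Proof. induction n as [|n IH]; simpl; [ring|]. rewrite IH. ring. Qed.

Lemma rsum_scal n c F : rsum n (fun i => c * F i) = c * rsum n F.
Proof. induction n as [|n IH]; simpl; [ring|]. rewrite IH. ring. Qed.

Lemma rsum_0 n : rsum n (fun _ => 0) = 0.
Proof. induction n as [|n IH]; simpl; [|rewrite IH]; ring. Qed.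

Lemma rsum_add m n F : rsum (m + n) F = rsum m F + rsum n (fun i => F (m + i)%nat).
Proof.
  induction n as [|n IH]; simpl; [rewrite Nat.add_0_r; ring|].
  rewrite Nat.add_succ_r. simpl. rewrite IH. ring.
Qed.

Lemma rsum_delta n k F :
  (k < n)%nat -> rsum n (fun i => F i * (if Nat.eq_dec i k then 1 else 0)) = F k.
Proof.
  induction n as [|n IH]; simpl; intros Hk; [lia|].
  destruct (Nat.eq_dec n k) as [->|Hn].
  - rewrite (rsum_ext _ _ (fun _ => 0)), rsum_0; [ring|].
    intros i Hi. destruct (Nat.eq_dec i k); [lia|ring].
  - rewrite IH by lia. ring.
Qed.

Lemma lsum_ext {A : Type} (f g : A -> R) l : (forall a, f a = g a) -> lsum f l = lsum g l.
Proof. intros H. induction l as [|a l IH]; simpl; [|rewrite H, IH]; reflexivity. Qed.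

Lemma lsum_ext_in {A : Type} (P : A -> Prop) (f g : A -> R) l :
  List.Forall P l -> (forall a, P a -> f a = g a) -> lsum f l = lsum g l.
Proof. intros Hl H. induction Hl as [|a l Ha Hl IH]; simpl; [|rewrite H, IH]; auto. Qed.

Lemma lsum_plus {A : Type} (f g : A -> R) l :
  lsum (fun a => f a + g a) l = lsum f l + lsum g l.
Proof. induction l as [|a l IH]; simpl; [|rewrite IH]; ring. Qed.

Lemma lsum_scal {A : Type} c (f : A -> R) l : lsum (fun a => c * f a) l = c * lsum f l.
Proof. induction l as [|a l IH]; simpl; [|rewrite IH]; ring. Qed.

Lemma lsum_map {A A' : Type} (f : A' -> R) (e : A -> A') l :
  lsum f (map e l) = lsum (fun a => f (e a)) l.
Proof. induction l as [|a l IH]; simpl; [|rewrite IH]; reflexivity. Qed.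

Lemma lsum_rsum {A : Type} n (F : nat -> A -> R) l :
  lsum (fun a => rsum n (fun i => F i a)) l = rsum n (fun i => lsum (F i) l).
Proof.
  induction l as [|a l IH]; simpl; [symmetry; apply rsum_0|].
  rewrite IH, <- rsum_plus. reflexivity.
Qed.

(* Gaussian elimination on the last coordinate. *)
Lemma span_or_functional {I : Type} (P : I -> Prop) d (v : I -> nat -> R) (w : nat -> R) :
  (exists l : list (R * I), List.Forall (fun p => P (snd p)) l /\
     forall i, (i < d)%nat -> lsum (fun p => fst p * v (snd p) i) l = w i) \/
  (exists a : nat -> R, (forall s, P s -> rsum d (fun i => a i * v s i) = 0) /\
     rsum d (fun i => a i * w i) <> 0).
Proof.
  revert v w. induction d as [|d IH]; intros v w.
  - left. exists nil. split; [constructor|]. intros i Hi. lia.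
  - destruct (classic (exists s0, P s0 /\ v s0 d <> 0)) as [(s0 & Hs0 & Hv0)|Hno].
    + destruct (IH (fun s i => v s i - v s d / v s0 d * v s0 i)
                   (fun i => w i - w d / v s0 d * v s0 i)) as [(l & Hl & E)|(a & Ha & Hw)].
      * left. pose (c := w d / v s0 d - lsum (fun p => fst p * v (snd p) d) l / v s0 d).
        exists ((c, s0) :: l). split; [now constructor|].
        intros i Hi. simpl. destruct (Nat.eq_dec i d) as [->|Hid].
        -- unfold c. field. exact Hv0.
        -- specialize (E i ltac:(lia)). simpl in E.
           rewrite (lsum_ext _ (fun p => fst p * v (snd p) i +
             - (v s0 i / v s0 d) * (fst p * v (snd p) d))) in E
             by (intros p; field; exact Hv0).
           rewrite lsum_plus, lsum_scal in E. unfold c.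
           replace (lsum (fun p => fst p * v (snd p) i) l) with
             (w i - w d / v s0 d * v s0 i +
                v s0 i / v s0 d * lsum (fun p => fst p * v (snd p) d) l) by lra.
           field. exact Hv0.
      * right. pose (A := rsum d (fun i => a i * v s0 i)).
        (* This last coefficient makes the functional vanish at the pivot [s0]; on any [z] it then
           equals the given functional on the reduced [z]. *)
        exists (fun i => if Nat.eq_dec i d then - A / v s0 d else a i).
        assert (Hsum : forall z : nat -> R,
          rsum (S d) (fun i => (if Nat.eq_dec i d then - A / v s0 d else a i) * z i) =
          rsum d (fun i => a i * (z i - z d / v s0 d * v s0 i))).
        { intros z. simpl. destruct (Nat.eq_dec d d) as [_|]; [|easy].
          rewrite (rsum_ext d _ (fun i => a i * z i)).
          2:{ intros i Hi. destruct (Nat.eq_dec i d); [lia|reflexivity]. }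
          rewrite (rsum_ext d (fun i => a i * (z i - z d / v s0 d * v s0 i))
            (fun i => a i * z i + - (z d / v s0 d) * (a i * v s0 i))) by (intros; ring).
          rewrite rsum_plus, rsum_scal. fold A. field. exact Hv0. }
        split.
        -- intros s Hs. rewrite (Hsum (v s)). now apply Ha.
        -- now rewrite Hsum.
    + assert (Hv : forall s, P s -> v s d = 0).
      { intros s Hs. apply NNPP. intros Hd. apply Hno. now exists s. }
      destruct (Req_dec (w d) 0) as [Hw|Hw].
      * destruct (IH v w) as [(l & Hl & E)|(a & Ha & Haw)].
        -- left. exists l. split; [exact Hl|]. intros i Hi.
           destruct (Nat.eq_dec i d) as [->|Hid]; [|apply E; lia].
           rewrite Hw, (lsum_ext_in _ _ (fun _ => 0 * 0) l Hl).
           ++ rewrite lsum_scal. ring.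
           ++ intros p Hp. rewrite Hv by exact Hp. ring.
        -- right. exists a. simpl. split.
           ++ intros s Hs. rewrite Ha, Hv by exact Hs. ring.
           ++ rewrite Hw. lra.
      * right. exists (fun i => if Nat.eq_dec i d then 1 else 0).
        assert (Hz : forall z : nat -> R,
          rsum (S d) (fun i => (if Nat.eq_dec i d then 1 else 0) * z i) = z d).
        { intros z. rewrite <- (rsum_delta (S d) d z) by lia.
          apply rsum_ext. intros; ring. }
        split; [intros s Hs; rewrite (Hz (v s)); now apply Hv|]. now rewrite Hz.
Qed.

(** * Linear combinations and pullbacks of quasimorphisms and their forms *)

Lemma HQinv_rsum {G : group} (N : G -> Prop) n (a : nat -> R) (fs : nat -> G -> R) :
  (forall i, (i < n)%nat -> HQinv G N (fs i)) ->
  HQinv G N (fun x => rsum n (fun i => a i * fs i x)).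
Proof.
  induction n as [|n IH]; intros Hf; simpl.
  - repeat split.
    + exists 0. intros. replace (0 - 0 - 0) with 0 by ring. rewrite Rabs_R0. lra.
    + intros. ring.
  - destruct IH as ([D HD] & Hz & Hc); [auto|].
    destruct (Hf n ltac:(lia)) as ([D' HD'] & Hz' & Hc'). repeat split.
    + exists (D + Rabs (a n) * D'). intros x y Hx Hy.
      specialize (HD x y Hx Hy). specialize (HD' x y Hx Hy).
      apply (Rmult_le_compat_l (Rabs (a n))) in HD'; [|apply Rabs_pos].
      rewrite <- Rabs_mult in HD'.
      apply Rabs_le_between in HD, HD'. apply Rabs_le. lra.
    + intros x m Hx. rewrite Hz, Hz' by exact Hx. ring.
    + intros g x Hx. now rewrite Hc, Hc'.
Qed.

Lemma comm_form_rsum {G : group} (L : G -> Prop) n (a : nat -> R) fs B :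
  (forall i, (i < n)%nat -> exists D, comm_form L (fs i) D (B i)) ->
  exists D, comm_form L (fun x => rsum n (fun i => a i * fs i x)) D
    (fun g x => rsum n (fun i => a i * B i g x)).
Proof.
  induction n as [|n IH]; intros Hf; simpl.
  - exists 0. repeat split; intros; try ring.
    replace (0 - 0) with 0 by ring. rewrite Rabs_R0. lra.
  - destruct IH as (D & [Hl Hr] & HD); [auto|].
    destruct (Hf n ltac:(lia)) as (D' & [Hl' Hr'] & HD').
    exists (D + Rabs (a n) * D'). repeat split.
    + intros g h x Hx. rewrite Hl, Hl' by exact Hx. ring.
    + intros g x y Hx Hy. rewrite Hr, Hr' by assumption. ring.
    + intros g x Hx. specialize (HD g x Hx). specialize (HD' g x Hx).
      apply (Rmult_le_compat_l (Rabs (a n))) in HD'; [|apply Rabs_pos].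
      rewrite <- Rabs_mult in HD'.
      apply Rabs_le_between in HD, HD'. apply Rabs_le. lra.
Qed.

Lemma wform_rsum {G : group} n (a : nat -> R) (B : nat -> G -> G -> R) W :
  wform (fun g x => rsum n (fun i => a i * B i g x)) W =
  rsum n (fun i => a i * wform (B i) W).
Proof.
  unfold wform. rewrite (lsum_rsum n (fun i p => a i * B i (fst p) (snd p))).
  apply rsum_ext. intros i _. apply lsum_scal.
Qed.

Definition relation {G : group} (L : G -> Prop) (W : list (G * G)) : Prop :=
  wover L W /\ wprod W 1 = gone.

Definition wmap {G H : group} (phi : G -> H) (W : list (G * G)) : list (H * H) :=
  map (fun p => (phi (fst p), phi (snd p))) W.

Lemma wform_wmap {G H : group} (phi : G -> H) B W :
  wform B (wmap phi W) = wform (fun g x => B (phi g) (phi x)) W.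
Proof. apply lsum_map. Qed.

Lemma hom_wprod {G H : group} (phi : G -> H) W m :
  is_hom G H phi -> phi (wprod W m) = wprod (wmap phi W) m.
Proof.
  intros Hphi. induction W as [|[g x] W IH]; [now apply hom_one|].
  change (wprod ((g, x) :: W) m) with (gmul (comm g (zpow x m)) (wprod W m)).
  now rewrite Hphi, hom_comm, hom_zpow, IH by exact Hphi.
Qed.

Lemma relation_wmap {G H : group} (phi : G -> H) (L : G -> Prop) (L' : H -> Prop) W :
  is_hom G H phi -> (forall x, L x -> L' (phi x)) -> relation L W -> relation L' (wmap phi W).
Proof.
  intros Hphi HL [HW HW1]. split.
  - unfold wover, wmap. rewrite Forall_map. revert HW. apply Forall_impl. intros p. apply HL.
  - rewrite <- hom_wprod, HW1 by exact Hphi. now apply hom_one.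
Qed.

Lemma HQinv_pullback {G H : group} (phi : G -> H) (N : G -> Prop) (N' : H -> Prop) f :
  is_hom G H phi -> (forall x, N x -> N' (phi x)) -> HQinv H N' f ->
  HQinv G N (fun x => f (phi x)).
Proof.
  intros Hphi HN ([D HD] & Hz & Hc). repeat split.
  - exists D. intros x y Hx Hy. rewrite Hphi. auto.
  - intros x n Hx. rewrite hom_zpow by exact Hphi. auto.
  - intros g x Hx. rewrite !Hphi, hom_inv by exact Hphi. auto.
Qed.

Lemma comm_form_pullback {G H : group} (phi : G -> H) (L : G -> Prop) (L' : H -> Prop) f D B :
  is_hom G H phi -> (forall x, L x -> L' (phi x)) -> comm_form L' f D B ->
  comm_form L (fun x => f (phi x)) D (fun g x => B (phi g) (phi x)).
Proof.
  intros Hphi HL [[Hl Hr] HD]. repeat split.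
  - intros g h x Hx. rewrite Hphi. auto.
  - intros g x y Hx Hy. rewrite Hphi. auto.
  - intros g x Hx. rewrite hom_comm by exact Hphi. auto.
Qed.

(* Otherwise some combination of the [fs i] and of the pullbacks of the [es j], involving
   [fs k], has a form vanishing on all relations, and is decomposable. *)
Lemma dual_relations {G H : group} (phi : G -> H) (L : G -> Prop) (L' : H -> Prop)
    t (fs : nat -> G -> R) (B : nat -> G -> G -> R) n (es : nat -> H -> R)
    (B' : nat -> H -> H -> R) k :
  is_hom G H phi -> normal L -> normal L' -> (forall x, L x -> L' (phi x)) ->
  (forall i, (i < t)%nat -> HQinv G (commsub L) (fs i)) ->
  (forall i, (i < t)%nat -> exists D, comm_form L (fs i) D (B i)) ->
  (forall j, (j < n)%nat -> HQinv H (commsub L') (es j)) ->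
  (forall j, (j < n)%nat -> exists D, comm_form L' (es j) D (B' j)) ->
  (forall c : nat -> R,
    (exists h psi nu, Hom1inv G (commsub L) h /\ HQinv G L psi /\ HQinv H (commsub L') nu /\
      forall x, commsub L x -> rsum t (fun i => c i * fs i x) = h x + psi x + nu (phi x)) ->
    forall i, (i < t)%nat -> c i = 0) ->
  (k < t)%nat ->
  exists l : list (R * list (G * G)), List.Forall (fun p => relation L (snd p)) l /\
    (forall i, (i < t)%nat -> lsum (fun p => fst p * wform (B i) (snd p)) l =
       if Nat.eq_dec i k then 1 else 0) /\
    (forall j, (j < n)%nat -> lsum (fun p => fst p * wform (B' j) (wmap phi (snd p))) l = 0).
Proof.
  intros Hphi HL HL' HLL Hfs HB Hes HB' Hind Hk.
  (* Indices below [t] carry the forms of the [fs i], the next [n] the pullbacks from [H], so that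
     one system of [t + n] equations is solved. *)
  pose (F := fun i g x => if lt_dec i t then B i g x else B' (i - t)%nat (phi g) (phi x)).
  pose (gs := fun i x => if lt_dec i t then fs i x else es (i - t)%nat (phi x)).
  destruct (span_or_functional (relation L) (t + n) (fun W i => wform (F i) W)
    (fun i => if Nat.eq_dec i k then 1 else 0)) as [(l & Hl & E)|(a & Ha & Hak)].
  - exists l. split; [exact Hl|]. split.
    + intros i Hi. rewrite <- E by lia. apply lsum_ext. intros p. unfold F.
      destruct (lt_dec i t); [reflexivity|lia].
    + intros j Hj. specialize (E (t + j)%nat ltac:(lia)).
      destruct (Nat.eq_dec (t + j) k); [lia|]. rewrite <- E. apply lsum_ext. intros p.
      rewrite wform_wmap. unfold F. destruct (lt_dec (t + j) t); [lia|].
      now replace (t + j - t)%nat with j by lia.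
  (* The functional takes the value [a k] at the target vector, and independence in the cokernel
     forces [a k = 0]. *)
  - exfalso. apply Hak. rewrite rsum_delta by lia.
    assert (Hgs : forall i, (i < t + n)%nat -> HQinv G (commsub L) (gs i)).
    { intros i Hi. unfold gs. destruct (lt_dec i t) as [Hit|Hit]; [now apply Hfs|].
      apply (HQinv_pullback phi (commsub L) (commsub L')); [exact Hphi| |apply Hes; lia].
      intros x. now apply commsub_hom. }
    assert (HF : forall i, (i < t + n)%nat -> exists D, comm_form L (gs i) D (F i)).
    { intros i Hi. unfold gs, F. destruct (lt_dec i t) as [Hit|Hit]; [now apply HB|].
      destruct (HB' (i - t)%nat ltac:(lia)) as [D HD]. exists D.
      now apply comm_form_pullback with L'. }
    destruct (comm_form_rsum L (t + n) a gs F HF) as [D HD].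
    destruct (quasimorphism_decomposition L (fun x => rsum (t + n) (fun i => a i * gs i x)) D
      (fun g x => rsum (t + n) (fun i => a i * F i g x))) as (h & psi & Hh & Hpsi & E);
      [exact HL|now apply HQinv_rsum|exact HD| |].
    { intros W HW HW1. rewrite wform_rsum. apply Ha. now split. }
    apply Hind; [|exact Hk].
    (* The pullback part of the decomposed combination moves to the right-hand side, hence the
       sign. *)
    exists h, psi, (fun y => rsum n (fun j => - a (t + j)%nat * es j y)).
    split; [exact Hh|]. split; [exact Hpsi|].
    split; [now apply (HQinv_rsum _ n (fun j => - a (t + j)%nat))|].
    intros x Hx. rewrite <- E by exact Hx. rewrite rsum_add.
    rewrite (rsum_ext t (fun i => a i * gs i x) (fun i => a i * fs i x)).
    2:{ intros i Hi. unfold gs. destruct (lt_dec i t); [reflexivity|lia]. }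
    rewrite (rsum_ext n (fun i => a (t + i)%nat * gs (t + i)%nat x)
      (fun j => (-1) * (- a (t + j)%nat * es j (phi x)))).
    2:{ intros j Hj. unfold gs. destruct (lt_dec (t + j) t); [lia|].
        replace (t + j - t)%nat with j by lia. ring. }
    rewrite rsum_scal. ring.
Qed.

(** * Products of deformed relations *)

(** Per letter, one commutator undoes the conjugation by [x^m] in the expansion of [[g, x^m x^n]],
    and one moves [[g, x^n]] past the remaining product. The elements moved lie in [[G, L]], so
    these are commutators with [[G, L]]. *)
Lemma wprod_add_near {G : group} (L : G -> Prop) W m n :
  normal L -> wover L W ->
  near (commsub L) (2 * length W) (wprod W (m + n)) (gmul (wprod W m) (wprod W n)).
Proof.
  intros HL HW. assert (HN : normal (commsub L)) by now apply commsub_normal.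
  assert (HLN : forall g x, L x -> commsub L (comm g x)).
  { intros g x Hx. apply gen_in. now exists g, x. }
  induction HW as [|[g x] W Hx HW IH].
  - unfold wprod; simpl. rewrite gmul1. apply near_refl.
  - change (wprod ((g, x) :: W)) with (fun m => gmul (comm g (zpow x m)) (wprod W m)).
    simpl in Hx |- *. replace (S (length W + S (length W + 0)))
      with (1 + 2 * length W + 1)%nat by lia.
    apply near_trans with
      (gmul (gmul (comm g (zpow x m)) (comm g (zpow x n))) (gmul (wprod W m) (wprod W n))).
    + apply near_mul; [exact HN| |exact IH]. rewrite zpow_add, comm_mul_r.
      apply near_mul_l; [exact HN|]. apply near_conj. apply HLN. now apply normal_zpow.
    + rewrite !gassoc. apply near_mul_l; [exact HN|]. rewrite !gmulA.
      apply near_mul_r; [exact HN|]. apply near_swap. now apply (wprod_normal L).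
Qed.

Lemma wprod_0 {G : group} (W : list (G * G)) : wprod W 0 = gone.
Proof.
  induction W as [|[g x] W IH]; [reflexivity|].
  change (wprod ((g, x) :: W) 0) with (gmul (comm g gone) (wprod W 0)).
  rewrite IH. now grp.
Qed.

(** Here the relation is used: up to [2 * length W] commutators, adding 1 to the exponent multiplies
    by [wprod W 1], which is trivial. *)
Lemma wprod_shift_near {G : group} (L : G -> Prop) W m d :
  normal L -> relation L W ->
  near (commsub L) (d * (2 * length W)) (wprod W (m + Z.of_nat d)) (wprod W m).
Proof.
  intros HL [HW HW1]. induction d as [|d IH].
  - rewrite Z.add_0_r. apply near_refl.
  - replace (m + Z.of_nat (S d))%Z with (m + Z.of_nat d + 1)%Z by lia. simpl Nat.mul.
    eapply near_trans; [now apply wprod_add_near|]. rewrite HW1, gmul_1_r. exact IH.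
Qed.

Lemma wprod_near {G : group} (L : G -> Prop) W m m' b :
  normal L -> relation L W -> (Z.abs (m - m') <= Z.of_nat b)%Z ->
  near (commsub L) (b * (2 * length W)) (wprod W m) (wprod W m').
Proof.
  intros HL HW Hb. set (d := Z.to_nat (Z.abs (m - m'))).
  apply (near_mono _ (d * (2 * length W))); [unfold d; nia|].
  destruct (Z_le_gt_dec m m').
  - apply near_sym; [now apply commsub_normal|].
    replace m' with (m + Z.of_nat d)%Z by lia. now apply wprod_shift_near.
  - replace m with (m' + Z.of_nat d)%Z by lia. now apply wprod_shift_near.
Qed.

(** A term [(c, i, W)] contributes [wprod W m] with [m] the integer part of [c * u i]. *)
Record term (G : group) := Term { coef : R; idx : nat; word : list (G * G) }.
Arguments Term {G}.
Arguments coef {G}.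
Arguments idx {G}.
Arguments word {G}.

Definition tprod {G : group} (m : term G -> Z) (T : list (term G)) : G :=
  gprod (map (fun p => wprod (word p) (m p)) T).

Definition trelation {G : group} (L : G -> Prop) (T : list (term G)) : Prop :=
  List.Forall (fun p => relation L (word p)) T.

Lemma tprod_normal {G : group} (L : G -> Prop) m T :
  normal L -> trelation L T -> commsub L (tprod m T).
Proof.
  intros HL HT. assert (HN : normal (commsub L)) by now apply commsub_normal.
  apply (normal_gprod (commsub L)); [exact HN|]. rewrite Forall_map.
  revert HT. apply Forall_impl. intros p [Hp _].
  apply (wprod_normal L); auto. intros g x Hx. apply gen_in. now exists g, x.
Qed.

Lemma tprod_near {G : group} (L : G -> Prop) (b : term G -> R) T :
  normal L -> trelation L T ->
  exists K, forall m m',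
    List.Forall (fun p => Rabs (IZR (m p) - IZR (m' p)) <= b p) T ->
    near (commsub L) K (tprod m T) (tprod m' T).
Proof.
  intros HL HT. induction HT as [|p T Hp HT [K IH]].
  - exists O. intros m m' _. apply near_refl.
  - destruct (nfloor_ex (Rabs (b p)) (Rabs_pos _)) as [n [_ Hn]].
    exists (S n * (2 * length (word p)) + K)%nat. intros m m' Hm.
    inversion Hm as [|? ? Hmp HmT]; subst. 
    apply near_mul; [now apply commsub_normal| |exact (IH m m' HmT)].
    apply wprod_near; [exact HL|exact Hp|]. apply le_IZR.
    rewrite abs_IZR, minus_IZR, <- INR_IZR_INZ, S_INR.
    pose proof (Rle_abs (b p)). lra.
Qed.

Lemma tprod_add_near {G : group} (L : G -> Prop) T :
  normal L -> trelation L T ->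
  exists K, forall m m' : term G -> Z,
    near (commsub L) K (tprod (fun p => (m p + m' p)%Z) T) (gmul (tprod m T) (tprod m' T)).
Proof.
  intros HL HT. assert (HN : normal (commsub L)) by now apply commsub_normal.
  induction HT as [|p T Hp HT [K IH]].
  - exists O. intros m m'. unfold tprod; simpl. rewrite gmul1. apply near_refl.
  - exists (2 * length (word p) + K + 1)%nat. intros m m'.
    change (tprod m (p :: T)) with (gmul (wprod (word p) (m p)) (tprod m T)).
    change (tprod m' (p :: T)) with (gmul (wprod (word p) (m' p)) (tprod m' T)).
    eapply near_trans.
    + apply near_mul; [exact HN|apply wprod_add_near; [exact HL|apply Hp]|apply IH].
    + rewrite !gassoc. apply near_mul_l; [exact HN|]. rewrite !gmulA.
      apply near_mul_r; [exact HN|]. apply near_swap. now apply tprod_normal.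
Qed.

(** The product is near the one with all exponents 0, which is trivial, and [near] counts
    commutators with [[G, L]]. *)
Lemma tprod_commsub {G : group} (L : G -> Prop) m T :
  normal L -> trelation L T -> commsub (commsub L) (tprod m T).
Proof.
  intros HL HT.
  destruct (tprod_near L (fun p => Rabs (IZR (m p))) T HL HT) as [K HK].
  specialize (HK m (fun _ => 0%Z)).
  replace (tprod (fun _ => 0%Z) T) with (@gone G) in HK.
  - apply (cl_le_commsub (commsub L) _ (K + 0)); [now apply commsub_normal|].
    eapply near_cl_le; [|apply cl_le_0]. apply HK.
    apply Forall_forall. intros p _. rewrite Rminus_0_r. lra.
  - clear. unfold tprod. induction T as [|p T IH]; [reflexivity|].
    simpl. rewrite wprod_0, <- IH. now grp.
Qed.

Lemma tprod_cl_le {G : group} (L : G -> Prop) T :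
  normal L -> trelation L T -> exists K, forall m, cl_le L (tprod m T) K.
Proof.
  intros HL HT. induction HT as [|p T [Hp _] HT [K IH]].
  - exists O. intros m. apply cl_le_0.
  - exists (length (word p) + K)%nat. intros m. apply cl_le_mul; [|apply IH].
    induction Hp as [|[g x] W Hx HW IHW]; [apply cl_le_0|].
    apply (cl_le_mul L _ _ 1 (length W)); [|exact IHW].
    apply cl_le_comm. now apply normal_zpow.
Qed.

(** The constant of [tprod_form]: each term costs, in units of [D], 2 per letter for the deformed
    word, 2 per letter for rounding its exponent, and 1 for splitting it off. *)
Definition tlength {G : group} (T : list (term G)) : R :=
  lsum (fun p => 4 * INR (length (word p)) + 1) T.

Lemma Int_part_bounds r : r - 1 < IZR (Int_part r) <= r.
Proof. destruct (base_Int_part r). lra. Qed.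

(** Rounding [r p] changes the main term by at most the absolute value of the form on a relation.
    This is at most [2 D] per letter, by [wprod_form] at exponent 1, where [nu gone = 0]. *)
Lemma tprod_form {G : group} (L : G -> Prop) nu D B (r : term G -> R) T :
  normal L -> HQinv G (commsub L) nu -> defect_le (commsub L) nu D ->
  comm_form L nu D B -> trelation L T ->
  Rabs (nu (tprod (fun p => Int_part (r p)) T) - lsum (fun p => r p * wform B (word p)) T)
    <= D * tlength T.
Proof.
  intros HL H HD HB HT. assert (HN : normal (commsub L)) by now apply commsub_normal.
  assert (HLN : forall g x, L x -> commsub L (comm g x)).
  { intros g x Hx. apply gen_in. now exists g, x. }
  induction HT as [|p T Hp HT IH].
  - unfold tprod, tlength; simpl. rewrite (HQinv_one (commsub L)) by assumption.
    rewrite Rminus_0_r, Rabs_R0. lra.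
  - change (tprod (fun p => Int_part (r p)) (p :: T)) with
      (gmul (wprod (word p) (Int_part (r p))) (tprod (fun p => Int_part (r p)) T)).
    unfold tlength in *. simpl lsum. set (s := lsum _ T) in *. set (n := INR (length (word p))).
    destruct Hp as [Hp Hp1].
    pose proof (HD _ _ (wprod_normal L (commsub L) _ (Int_part (r p)) HL HN HLN Hp)
      (tprod_normal L (fun p => Int_part (r p)) T HL HT)) as E1.
    pose proof (wprod_form L (commsub L) nu D B (word p) (Int_part (r p)) HL HN HLN H HD HB Hp)
      as E2.
    pose proof (wprod_form L (commsub L) nu D B (word p) 1 HL HN HLN H HD HB Hp) as E3.
    rewrite Hp1, (HQinv_one (commsub L)) in E3 by assumption. fold n in E2, E3.
    pose proof (Int_part_bounds (r p)) as Hf.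
    assert (E4 : Rabs ((IZR (Int_part (r p)) - r p) * wform B (word p)) <= 2 * D * n).
    { rewrite Rabs_mult. replace (2 * D * n) with (1 * (2 * D * n)) by ring.
      apply Rmult_le_compat; try apply Rabs_pos.
      - apply Rabs_le. lra.
      - rewrite Rmult_1_l, <- Rabs_Ropp in E3. eapply Rle_trans; [right|exact E3].
        f_equal. ring. }
    apply Rabs_le_between in E1, E2, E4, IH. apply Rabs_le. lra.
Qed.

Definition tmap {G H : group} (phi : G -> H) (p : term G) : term H :=
  Term (coef p) (idx p) (wmap phi (word p)).

Lemma trelation_tmap {G H : group} (phi : G -> H) (L : G -> Prop) (L' : H -> Prop) T :
  is_hom G H phi -> (forall x, L x -> L' (phi x)) -> trelation L T ->
  trelation L' (map (tmap phi) T).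
Proof.
  intros Hphi HL. unfold trelation. rewrite Forall_map. apply Forall_impl.
  intros p. now apply relation_wmap.
Qed.

Lemma hom_tprod {G H : group} (phi : G -> H) (r : R -> nat -> Z) T :
  is_hom G H phi ->
  phi (tprod (fun p => r (coef p) (idx p)) T) =
  tprod (fun p => r (coef p) (idx p)) (map (tmap phi) T).
Proof.
  intros Hphi. induction T as [|p T IH]; [now apply hom_one|].
  change (tprod (fun p => r (coef p) (idx p)) (p :: T)) with
    (gmul (wprod (word p) (r (coef p) (idx p))) (tprod (fun p => r (coef p) (idx p)) T)).
  now rewrite Hphi, hom_wprod, IH by exact Hphi.
Qed.

Definition tmult {G : group} (u : nat -> Z) (p : term G) : R := coef p * IZR (u (idx p)).

Definition tpsi {G : group} (T : list (term G)) (u : nat -> Z) : G :=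
  tprod (fun p => Int_part (tmult u p)) T.

Lemma hom_tpsi {G H : group} (phi : G -> H) T u :
  is_hom G H phi -> phi (tpsi T u) = tpsi (map (tmap phi) T) u.
Proof. apply (hom_tprod phi (fun c i => Int_part (c * IZR (u i)))). Qed.

(** * The coarse embedding *)

Lemma rsum_ge n F i : (forall i, (i < n)%nat -> 0 <= F i) -> (i < n)%nat -> F i <= rsum n F.
Proof.
  induction n as [|n IH]; intros HF Hi; [lia|]. simpl.
  assert (0 <= rsum n F).
  { clear IH Hi. induction n as [|n IH]; simpl; [lra|].
    assert (0 <= rsum n F) by auto. assert (0 <= F n) by auto. lra. }
  destruct (Nat.eq_dec i n) as [->|Hin]; [lra|].
  assert (F i <= rsum n F) by (apply IH; [auto|lia]). assert (0 <= F n) by auto. lra.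
Qed.

Lemma rsum_le_const n F C : (forall i, (i < n)%nat -> F i <= C) -> rsum n F <= INR n * C.
Proof.
  induction n as [|n IH]; intros HF; [simpl; lra|]. rewrite S_INR. simpl.
  assert (rsum n F <= INR n * C) by auto. assert (F n <= C) by auto. lra.
Qed.

Lemma d1_coord t u v i : (i < t)%nat -> Rabs (IZR (u i) - IZR (v i)) <= Defs.d1 t u v.
Proof.
  intros Hi. rewrite <- minus_IZR, <- abs_IZR.
  apply (rsum_ge t (fun i => IZR (Z.abs (u i - v i)))); [|exact Hi].
  intros j _. apply IZR_le. lia.
Qed.

Lemma d1_le t u v C :
  (forall i, (i < t)%nat -> Rabs (IZR (u i) - IZR (v i)) <= C) -> Defs.d1 t u v <= INR t * C.
Proof.
  intros H. apply rsum_le_const. intros i Hi. rewrite abs_IZR, minus_IZR. now apply H.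
Qed.

Lemma near_dscl {G : group} (N : G -> Prop) k x y :
  normal N -> near N k x y -> dscl N x y <= INR k.
Proof. intros HN H. apply scl_le_cl. now apply near_diff. Qed.

Lemma tpsi_add {G : group} (L : G -> Prop) T :
  normal L -> trelation L T ->
  exists C, forall u v,
    dscl (commsub L) (tpsi T (zt_add u v)) (gmul (tpsi T u) (tpsi T v)) <= C.
Proof.
  intros HL HT. assert (HN : normal (commsub L)) by now apply commsub_normal.
  destruct (tprod_near L (fun _ => 2) T HL HT) as [K1 HK1].
  destruct (tprod_add_near L T HL HT) as [K2 HK2].
  exists (INR (K1 + K2)). intros u v. apply near_dscl; [exact HN|].
  eapply near_trans; [|apply HK2]. apply HK1. apply Forall_forall. intros p _.
  pose proof (Int_part_bounds (tmult u p)). pose proof (Int_part_bounds (tmult v p)).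
  pose proof (Int_part_bounds (tmult (zt_add u v) p)).
  assert (tmult (zt_add u v) p = tmult u p + tmult v p).
  { unfold tmult, zt_add. rewrite plus_IZR. ring. }
  rewrite plus_IZR. apply Rabs_le. lra.
Qed.

Lemma tpsi_controlled {G : group} (L : G -> Prop) T t :
  normal L -> trelation L T -> List.Forall (fun p => (idx p < t)%nat) T ->
  forall r, exists s, forall u v, Defs.d1 t u v <= r -> dscl (commsub L) (tpsi T u) (tpsi T v) <= s.
Proof.
  intros HL HT Ht r.
  destruct (tprod_near L (fun p => Rabs (coef p) * r + 1) T HL HT) as [K HK].
  exists (INR K). intros u v Huv. apply near_dscl; [now apply commsub_normal|].
  apply HK. revert Ht. apply Forall_impl. intros p Hp.
  pose proof (Int_part_bounds (tmult u p)). pose proof (Int_part_bounds (tmult v p)).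
  assert (E : Rabs (tmult u p - tmult v p) <= Rabs (coef p) * r).
  { unfold tmult. rewrite <- Rmult_minus_distr_l, Rabs_mult.
    apply Rmult_le_compat_l; [apply Rabs_pos|].
    eapply Rle_trans; [exact (d1_coord t u v (idx p) Hp)|exact Huv]. }
  apply Rabs_le_between in E. apply Rabs_le. lra.
Qed.

Lemma uniform_bound t (P : nat -> R -> Prop) :
  (forall i c c', c <= c' -> P i c -> P i c') ->
  (forall i, (i < t)%nat -> exists c, P i c) -> exists C, 0 <= C /\ forall i, (i < t)%nat -> P i C.
Proof.
  intros Hmono. induction t as [|t IH]; intros H.
  - exists 0. split; [lra|]. intros; lia.
  - destruct IH as (C & HC & HP); [auto|]. destruct (H t ltac:(lia)) as [c Hc].
    exists (Rmax C c). split; [eapply Rle_trans; [exact HC|apply Rmax_l]|].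
    intros i Hi. destruct (Nat.eq_dec i t) as [->|Hit].
    + eapply Hmono; [apply Rmax_r|exact Hc].
    + eapply Hmono; [apply Rmax_l|apply HP; lia].
Qed.

(** The coarse inverse takes integer parts of the [fs i]: by duality they read off the coordinates
    of [u] up to a bounded error, and the easy half of Bavard duality makes this map controlled. *)
Theorem coarse_embedding {G : group} (L : G -> Prop) t (fs : nat -> G -> R)
    (B : nat -> G -> G -> R) T :
  normal L -> (1 <= t)%nat ->
  (forall i, (i < t)%nat -> HQinv G (commsub L) (fs i)) ->
  (forall i, (i < t)%nat -> exists D, 0 < D /\ defect_le (commsub L) (fs i) D /\
     comm_form L (fs i) D (B i)) ->
  trelation L T -> List.Forall (fun p => (idx p < t)%nat) T ->
  (forall u i, (i < t)%nat ->
     lsum (fun p => tmult u p * wform (B i) (word p)) T = IZR (u i)) ->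
  let X := fun x => exists u, x = tpsi T u in
  coarse_iso_Zt G (commsub L) (commsub (commsub L)) X t /\ ~ dbounded (commsub L) X.
Proof.
  intros HL Ht Hfs HB HT Hidx Hdual X.
  assert (HN : normal (commsub L)) by now apply commsub_normal.
  assert (HX : forall u, commsub (commsub L) (tpsi T u)) by (intros; now apply tprod_commsub).
  assert (HXN : forall u, commsub L (tpsi T u)) by (intros; now apply tprod_normal).
  destruct (uniform_bound t (fun i D => 0 < D /\ defect_le (commsub L) (fs i) D /\
      comm_form L (fs i) D (B i))) as (D & HD0 & HD).
  { intros i c c' Hc (H0 & H1 & H2 & H3). split; [lra|]. split; [|split; [exact H2|]].
    - intros x y Hx Hy. eapply Rle_trans; [now apply H1|exact Hc].
    - intros g x Hx. eapply Rle_trans; [now apply H3|exact Hc]. }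
  { exact HB. }
  assert (HDp : 0 < D) by apply (HD O Ht).
  pose (Phi := fun (x : G) (i : nat) => Int_part (fs i x)).
  pose (E := D * tlength T).
  assert (Heval : forall u i, (i < t)%nat -> Rabs (fs i (tpsi T u) - IZR (u i)) <= E).
  { intros u i Hi. rewrite <- (Hdual u i Hi). destruct (HD i Hi) as (_ & H1 & H2).
    apply (tprod_form L); auto. }
  assert (HPhiPsi : forall u, Defs.d1 t (Phi (tpsi T u)) u <= INR t * (E + 1)).
  { intros u. apply d1_le. intros i Hi. unfold Phi.
    pose proof (Int_part_bounds (fs i (tpsi T u))). specialize (Heval u i Hi).
    apply Rabs_le_between in Heval. apply Rabs_le. lra. }
  assert (HPhictl : forall r, exists s, forall x y, X x -> X y -> dscl (commsub L) x y <= r ->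
      Defs.d1 t (Phi x) (Phi y) <= s).
  { intros r. exists (INR t * (2 * D * r + D + 1)). intros ? ? [u ->] [v ->] Hr.
    apply d1_le. intros i Hi. unfold Phi. destruct (HD i Hi) as (_ & H1 & _).
    pose proof (quasimorphism_le_scl (commsub L) (fs i) D
      (gmul (ginv (tpsi T u)) (tpsi T v)) HN (Hfs i Hi) HDp H1
      ltac:(apply gen_mul; [apply gen_inv|]; apply HX)) as E1.
    fold (dscl (commsub L) (tpsi T u) (tpsi T v)) in E1.
    pose proof (defect_diff (commsub L) (fs i) D _ _ HN (Hfs i Hi) H1 (HXN u) (HXN v)) as E2.
    pose proof (Int_part_bounds (fs i (tpsi T u))). pose proof (Int_part_bounds (fs i (tpsi T v))).
    assert (2 * D * dscl (commsub L) (tpsi T u) (tpsi T v) <= 2 * D * r) by nra.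
    apply Rabs_le_between in E1, E2. apply Rabs_le. lra. }
  split.
  - exists (tpsi T), Phi. split; [exact HX|]. split; [unfold X; tauto|].
    split; [now apply tpsi_add|]. split; [now apply tpsi_controlled|].
    split; [|split; [exact HPhictl|split; [now exists (INR t * (E + 1))|]]].
    + exists (INR t * (D + 2)). intros a b Ha Hb. apply d1_le. intros i Hi.
      destruct (HD i Hi) as (_ & H1 & _).
      specialize (H1 a b ltac:(now apply commsub_sub) ltac:(now apply commsub_sub)).
      unfold zt_add, Phi. rewrite plus_IZR. pose proof (Int_part_bounds (fs i a)).
      pose proof (Int_part_bounds (fs i b)). pose proof (Int_part_bounds (fs i (gmul a b))).
      apply Rabs_le_between in H1. apply Rabs_le. lra.
    + destruct (tpsi_controlled L T t HL HT Hidx (INR t * (E + 1))) as [s Hs].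
      exists s. intros ? [u ->]. apply Hs, HPhiPsi.
  - intros [C HC]. destruct (HPhictl C) as [s Hs].
    (* [Phi] recovers the constant vector [z] and the zero vector up to an error each, so [z] is
       taken beyond [s] plus both errors. Coordinate 0 exists because [1 <= t]. *)
    destruct (archimed (s + 2 * (INR t * (E + 1)))) as [Hz _].
    set (z := up (s + 2 * (INR t * (E + 1)))) in *.
    specialize (Hs (tpsi T (fun _ => z)) (tpsi T (fun _ => 0%Z)) ltac:(now eexists)
      ltac:(now eexists) (HC _ _ ltac:(now eexists) ltac:(now eexists))).
    pose proof (HPhiPsi (fun _ => z)) as H1. pose proof (HPhiPsi (fun _ => 0%Z)) as H2.
    pose proof (d1_coord t (Phi (tpsi T (fun _ => z))) (fun _ => z) 0%nat Ht) as F1.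
    pose proof (d1_coord t (Phi (tpsi T (fun _ => 0%Z))) (fun _ => 0%Z) 0%nat Ht) as F2.
    pose proof (d1_coord t (Phi (tpsi T (fun _ => z))) (Phi (tpsi T (fun _ => 0%Z))) 0%nat Ht)
      as F3.
    apply Rabs_le_between in F1, F2, F3. lra.
Qed.

(** * The two boundedness statements and the assembly *)

Lemma dbounded_ambient {G : group} (L : G -> Prop) T :
  normal L -> trelation L T -> dbounded L (fun x => exists u, x = tpsi T u).
Proof.
  intros HL HT. destruct (tprod_cl_le L T HL HT) as [K HK].
  exists (INR (K + K)). intros ? ? [u ->] [v ->]. apply scl_le_cl.
  apply cl_le_mul; [apply cl_le_inv; [exact HL|]|]; apply HK.
Qed.

(** Modulo decomposable quasimorphisms, whose forms vanish on relations, each test quasimorphism is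
    a combination of the [es j]. Its main term on [tpsi T u] is therefore 0, and only the error of
    [tprod_form] remains. *)
Lemma dbounded_bavard {G : group} (L : G -> Prop) T n (es : nat -> G -> R)
    (B : nat -> G -> G -> R) :
  normal L -> trelation L T ->
  (forall j, (j < n)%nat -> exists D, comm_form L (es j) D (B j)) ->
  (forall f, HQinv G (commsub L) f -> exists c : nat -> R,
     W_denom G L (commsub L) (fun x => f x - rsum n (fun j => c j * es j x))) ->
  (forall u j, (j < n)%nat -> lsum (fun p => tmult u p * wform (B j) (word p)) T = 0) ->
  dbounded (commsub L) (fun x => exists u, x = tpsi T u).
Proof.
  intros HL HT HB Hfin Hdual. assert (HN : normal (commsub L)) by now apply commsub_normal.
  assert (Hlen : 0 <= tlength T).
  { unfold tlength. clear. induction T as [|p T IH]; simpl; [lra|].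
    pose proof (pos_INR (length (word p))). lra. }
  (* Two values of size at most [3 * tlength T], the defect 3 for their quotient, and the 1 lost in
     [bavard_bound]. *)
  exists (2 * (3 * tlength T) + 3 + 1). intros ? ? [u ->] [v ->].
  apply bavard_bound; [exact HN| |lra|].
  { apply gen_mul; [apply gen_inv|]; now apply tprod_commsub. }
  intros nu Hnu HD.
  destruct (comm_form_exists L (commsub L) nu 3 HL HN) as [Bnu HBnu]; auto.
  { intros g x Hx. apply gen_in. now exists g, x. }
  destruct (Hfin nu Hnu) as (c & h & psi & Hh & Hpsi & E).
  assert (Hform : forall W, relation L W -> wform Bnu W = rsum n (fun j => c j * wform (B j) W)).
  { intros W [HW HW1]. destruct (comm_form_rsum L n c es B HB) as [D' HD'].
    rewrite <- wform_rsum. apply Rminus_diag_uniq.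
    transitivity (wform (fun g x => Bnu g x - rsum n (fun j => c j * B j g x)) W).
    { unfold wform, Rminus. rewrite lsum_plus.
      rewrite (lsum_ext (fun p => - _) (fun p => -1 * rsum n (fun j => c j * B j (fst p) (snd p))))
        by (intros; ring). rewrite lsum_scal. ring. }
    apply (wform_relation L (fun x => nu x - rsum n (fun j => c j * es j x)) h psi (3 + D'));
      auto. destruct HBnu as [[Hl Hr] H3], HD' as [[Hl' Hr'] H3']. repeat split.
    - intros g k x Hx. rewrite Hl, Hl' by exact Hx. ring.
    - intros g x y Hx Hy. rewrite Hr, Hr' by assumption. ring.
    - intros g x Hx. specialize (H3 g x Hx). specialize (H3' g x Hx).
      apply Rabs_le_between in H3, H3'. apply Rabs_le. lra. }
  assert (Hval : forall u, Rabs (nu (tpsi T u)) <= 3 * tlength T).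
  { intros w. pose proof (tprod_form L nu 3 Bnu (tmult w) T HL Hnu HD HBnu HT) as H3.
    rewrite (lsum_ext_in _ _ (fun p => rsum n (fun j =>
      c j * (tmult w p * wform (B j) (word p)))) T HT) in H3.
    - rewrite (lsum_rsum n (fun j p => c j * (tmult w p * wform (B j) (word p)))) in H3.
      rewrite (rsum_ext n _ (fun _ => 0)), rsum_0, Rminus_0_r in H3; [exact H3|].
      intros j Hj. rewrite lsum_scal, Hdual by exact Hj. ring.
    - intros p Hp. rewrite Hform by exact Hp. rewrite <- rsum_scal. apply rsum_ext.
      intros; ring. }
  pose proof (defect_diff (commsub L) nu 3 _ _ HN Hnu HD
    (tprod_normal L (fun p => Int_part (tmult u p)) T HL HT)
    (tprod_normal L (fun p => Int_part (tmult v p)) T HL HT)) as E1.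
  fold (tpsi T u) (tpsi T v) in E1.
  pose proof (Hval u) as E2. pose proof (Hval v) as E3.
  apply Rabs_le_between in E1, E2, E3. apply Rabs_le. lra.
Qed.

Lemma choose_forms {G : group} (L : G -> Prop) n (fs : nat -> G -> R) :
  normal L -> (forall i, (i < n)%nat -> HQinv G (commsub L) (fs i)) ->
  exists B : nat -> G -> G -> R, forall i, (i < n)%nat ->
    exists D, 0 < D /\ defect_le (commsub L) (fs i) D /\ comm_form L (fs i) D (B i).
Proof.
  intros HL Hfs.
  assert (Hex : forall i, exists Bi, (i < n)%nat ->
    exists D, 0 < D /\ defect_le (commsub L) (fs i) D /\ comm_form L (fs i) D Bi).
  { intros i. destruct (lt_dec i n) as [Hi|Hi]; [|exists (fun _ _ => 0); tauto].
    destruct (HQinv_defect _ _ (Hfs i Hi)) as (D & HD0 & HD).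
    destruct (comm_form_exists L (commsub L) (fs i) D HL (commsub_normal L HL)) as [Bi HBi]; auto.
    - intros g x Hx. apply gen_in. now exists g, x.
    - exists Bi. intros _. now exists D. }
  exists (fun i => proj1_sig (constructive_indefinite_description _ (Hex i))).
  intros i. exact (proj2_sig (constructive_indefinite_description _ (Hex i))).
Qed.

(** The family dual to [k] gets the index [k], so its coefficients are multiplied by [u k]; after
    concatenation, Kronecker deltas select [u i]. One list [T] serves all [u]. *)
Lemma dual_terms {G H : group} (phi : G -> H) (L : G -> Prop) t n
    (B : nat -> G -> G -> R) (B' : nat -> H -> H -> R) :
  (forall k, (k < t)%nat ->
    exists l : list (R * list (G * G)), List.Forall (fun p => relation L (snd p)) l /\
    (forall i, (i < t)%nat -> lsum (fun p => fst p * wform (B i) (snd p)) l =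
       if Nat.eq_dec i k then 1 else 0) /\
    (forall j, (j < n)%nat -> lsum (fun p => fst p * wform (B' j) (wmap phi (snd p))) l = 0)) ->
  exists T, trelation L T /\ List.Forall (fun p => (idx p < t)%nat) T /\
    (forall u i, (i < t)%nat ->
       lsum (fun p => tmult u p * wform (B i) (word p)) T = IZR (u i)) /\
    (forall u j, (j < n)%nat ->
       lsum (fun p => tmult u p * wform (B' j) (word p)) (map (tmap phi) T) = 0).
Proof.
  intros Hdual.
  assert (Hpart : forall s, (s <= t)%nat ->
    exists T, trelation L T /\ List.Forall (fun p => (idx p < t)%nat) T /\
    (forall u i, (i < t)%nat -> lsum (fun p => tmult u p * wform (B i) (word p)) T =
       if lt_dec i s then IZR (u i) else 0) /\
    (forall u j, (j < n)%nat ->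
       lsum (fun p => tmult u p * wform (B' j) (word p)) (map (tmap phi) T) = 0)).
  { induction s as [|s IH]; intros Hs.
    - exists nil. repeat split; constructor.
    - destruct IH as (T & HT & Hidx & HB & HB'); [lia|].
      destruct (Hdual s ltac:(lia)) as (l & Hl & HlB & HlB').
      exists (map (fun p => Term (fst p) s (snd p)) l ++ T). repeat split.
      + apply List.Forall_app. split; [|exact HT]. rewrite Forall_map. exact Hl.
      + apply List.Forall_app. split; [|exact Hidx]. rewrite Forall_map.
        apply Forall_forall. intros p _. simpl. lia.
      + intros u i Hi. rewrite lsum_app, lsum_map, HB by exact Hi.
        rewrite (lsum_ext _ (fun p => IZR (u s) * (fst p * wform (B i) (snd p))))
          by (intros p; unfold tmult; simpl; ring).
        rewrite lsum_scal, HlB by exact Hi.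
        destruct (Nat.eq_dec i s) as [Hs'|Hs'], (lt_dec i s), (lt_dec i (S s));
          try lia; try rewrite Hs'; ring.
      + intros u j Hj. rewrite map_app, lsum_app, HB', map_map, lsum_map by exact Hj.
        rewrite (lsum_ext _ (fun p => IZR (u s) * (fst p * wform (B' j) (wmap phi (snd p)))))
          by (intros p; unfold tmult; simpl; ring).
        rewrite lsum_scal, HlB' by exact Hj. ring. }
  destruct (Hpart t (le_n t)) as (T & HT & Hidx & HB & HB'). exists T.
  repeat split; auto. intros u i Hi. rewrite HB by exact Hi.
  destruct (lt_dec i t); [reflexivity|lia].
Qed.

Theorem theorem12p6 (q : nat) (G H : group) (phi : G -> H) (t : nat) :
  (2 <= q)%nat ->
  W_findim G (lcs G (q - 1)) (lcs G q) ->
  W_findim H (lcs H (q - 1)) (lcs H q) ->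
  is_hom G H phi ->
  cokerT_dim q G H phi t ->
  (1 <= t)%nat ->
  exists X : G -> Prop,
    (forall x, X x -> lcs G (q + 1) x) /\
    coarse_iso_Zt G (lcs G q) (lcs G (q + 1)) X t /\
    ~ dbounded (lcs G q) X /\
    dbounded (lcs G (q - 1)) X /\
    dbounded (lcs H q) (fun y => exists x, X x /\ y = phi x).
Proof.
  intros Hq _ (n & es & Hes & Hfin) Hphi (fs & Hfs & Hind & _) Ht.
  destruct q as [|[|q]]; [lia|lia|]. clear Hq. unfold cokerT_denom in Hind.
  replace (S (S q) - 1)%nat with (S q) in * by lia.
  replace (S (S q) + 1)%nat with (S (S (S q))) by lia.
  rewrite !lcs_succ in *.
  assert (HL := lcs_normal G (S q)). assert (HL' := lcs_normal H (S q)).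
  assert (HLL := fun x => hom_lcs G H phi (S q) x Hphi).
  (* From here on, all that remains of the lower central series is that [L] and [L'] are normal and
     that [phi] maps [L] into [L']. *)
  set (L := lcs G (S q)) in *. set (L' := lcs H (S q)) in *. clearbody L L'.
  destruct (choose_forms L t fs HL Hfs) as [B HB].
  destruct (choose_forms L' n es HL' Hes) as [B' HB'].
  assert (HB0 : forall i, (i < t)%nat -> exists D, comm_form L (fs i) D (B i)).
  { intros i Hi. destruct (HB i Hi) as (D & _ & _ & HD). now exists D. }
  assert (HB0' : forall j, (j < n)%nat -> exists D, comm_form L' (es j) D (B' j)).
  { intros j Hj. destruct (HB' j Hj) as (D & _ & _ & HD). now exists D. }
  destruct (dual_terms phi L t n B B') as (T & HT & Hidx & Hdual & Hdual').
  { intros k Hk. now apply (dual_relations phi L L' t fs B n es B' k). }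
  exists (fun x => exists u, x = tpsi T u).
  split; [intros ? [u ->]; now apply tprod_commsub|].
  destruct (coarse_embedding L t fs B T) as [Hiso Hunb]; auto.
  split; [exact Hiso|]. split; [exact Hunb|]. split; [now apply dbounded_ambient|].
  (* The image of [tpsi T u] under [phi] is the same construction on the mapped relations, on which
     the forms of the [es j] were made to vanish. *)
  destruct (dbounded_bavard L' (map (tmap phi) T) n es B') as [C HC]; auto.
  { now apply (trelation_tmap phi L). }
  exists C. intros ? ? (? & [u ->] & ->) (? & [v ->] & ->).
  rewrite !hom_tpsi by exact Hphi. apply HC; now eexists.
Qed.
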